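(* Let $X$ be a geodesic space, and suppose $\bar{\pi}_1(X)$ is countable. Then for each $x\in X$ there is an open ball $B_{r_x}(x)$ centered at $x$ with the following property: if $\gamma$ is a path loop in $B_{r_x}(x)$, not necessarily based at $x$, then $\gamma$ lifts closed to $X_\varepsilon$ for all $\varepsilon>0$. In particular, if $\bar{\pi}_1(X)$ is countable, then $X$ is semilocally $r$-simply connected.
   Context: A geodesic space is a metric space in which any two points are joined by a curve whose length equals the distance between them. Let $X$ be a geodesic space with base point $*$ (the choice is immaterial up to isomorphism/equivalence). For $\varepsilon>0$, an $\varepsilon$-chain is a finite sequence $\{x_0,\dots,x_n\}$ in $X$ with $d(x_{i-1},x_i)<\varepsilon$ for all $i$. A basic move adds or removes one point, keeping the endpoints fixed and keeping the result an $\varepsilon$-chain; two $\varepsilon$-chains are $\varepsilon$-homotopic if connected by finitely many basic moves; $[\alpha]_\varepsilon$ is the resulting class. $X_\varepsilon$ is the set of classes of $\varepsilon$-chains starting at $*$, with metric $d_\varepsilon([\alpha]_\varepsilon,[\beta]_\varepsilon)$ equal to the infimum of lengths (sums of consecutive distances) of $\varepsilon$-chains in $[\alpha^{-1}\beta]_\varepsilon$; the endpoint map $\varphi_\varepsilon:X_\varepsilon\to X$ is a regular covering map. $\pi_\varepsilon(X)$ is the group, under concatenation, of classes of $\varepsilon$-chains that start and end at $*$. A strong $\varepsilon$-chain along a path $\gamma:[a,b]\to X$ is an $\varepsilon$-chain $\{\gamma(t_0),\dots,\gamma(t_n)\}$ for a partition $a=t_0<\dots<t_n=b$ with $\gamma([t_{i-1},t_i])\subset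 B_\varepsilon(\gamma(t_{i-1}))\cap B_\varepsilon(\gamma(t_i))$ for each $i$. The well-defined surjective homomorphism $h_\varepsilon:\pi_1(X)\to\pi_\varepsilon(X)$ sends $[\gamma]$ to the class of any strong $\varepsilon$-chain along $\gamma$. Put $K_\varepsilon=\ker h_\varepsilon$, $\pi_{cl}(X)=\bigcap_{\varepsilon>0}K_\varepsilon$, $\bar{\pi}_1(X)=\pi_1(X)/\pi_{cl}(X)$. A path loop is a closed continuous curve; it lifts closed to $X_\varepsilon$ if its lifts to $X_\varepsilon$ are loops (by regularity, all lifts are closed or all are open). $X$ is semilocally $r$-simply connected if each $x\in X$ is the center of an open ball $U$ such that every path loop in $U$ based at $x$ lifts closed to $X_\varepsilon$ for all $\varepsilon>0$. *)

(* Defs.v *)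
From HB Require Import structures.
From Stdlib Require Import Relations.
From mathcomp Require Import all_boot all_order all_algebra generic_quotient.
From mathcomp Require Import all_classical all_reals all_analysis.
From mathcomp Require Import ring lra.

Set Implicit Arguments.
Unset Strict Implicit.
Unset Printing Implicit Defensive.

Import Order.TTheory GRing.Theory Num.Theory.
Import numFieldNormedType.Exports.

Local Open Scope classical_set_scope.
Local Open Scope ring_scope.
Local Open Scope quotient_scope.

(* A chain x_0, x_1, ..., x_n is represented, as in path.v, by its first point
   x = x_0 and the sequence s = [:: x_1; ...; x_n]. *)
Section Chains.
Context {R : realType} {X : metricType R}.
Implicit Types (e : {posnum R}) (x y : X) (s t : seq X).

Definition eclose e : rel X := fun x y => mdist x y < e%:num.

Definition echain e x s : bool := path (eclose e) x s.

Definition chain_length x s : R := \sum_(p <- zip (x :: s) s) mdist p.1 p.2.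

Definition adds_point s s' : Prop :=
  exists s1 y s2, s = s1 ++ s2 /\ s' = s1 ++ y :: s2.

(* The first point x is kept by construction: adding a point in front of x
   while keeping the first point means adding a second copy of x, which is
   the same as adding x just after x. *)
Definition basic_move e x s s' : Prop :=
  [/\ echain e x s, echain e x s', last x s = last x s'
    & adds_point s s' \/ adds_point s' s].

Definition ehomotopic e x : seq X -> seq X -> Prop :=
  clos_refl_trans (seq X) (basic_move e x).

(* The reversed chain, which starts at last x s and ends at x. *)
Definition chain_inv x s : seq X := rev (belast x s).

Lemma eclose_sym e : symmetric (eclose e).
Proof. by move=> x y; rewrite /eclose metric_sym. Qed.

Lemma eclose_refl e x : eclose e x x.
Proof. by rewrite /eclose mdistxx. Qed.

Lemma basic_move_sym e x s s' : basic_move e x s s' -> basic_move e x s' s.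
Proof. by move=> [c c' l [a|a]]; split => //; [right|left]. Qed.

Lemma ehomotopic_refl e x s : ehomotopic e x s s.
Proof. exact: rt_refl. Qed.

Lemma ehomotopic_trans e x s t u :
  ehomotopic e x s t -> ehomotopic e x t u -> ehomotopic e x s u.
Proof. exact: rt_trans. Qed.

Lemma ehomotopic_sym e x s t : ehomotopic e x s t -> ehomotopic e x t s.
Proof.
elim=> [? ? /basic_move_sym ?|?|? ? ? _ + _]; [exact: rt_step|exact: rt_refl|].
by move=> h1 h2; exact: ehomotopic_trans h2 h1.
Qed.

Lemma ehomotopic_last e x s t : ehomotopic e x s t -> last x s = last x t.
Proof. by elim=> [? ? []|//|? ? ? _ -> _]. Qed.

Lemma ehomotopic_echain e x s t :
  ehomotopic e x s t -> echain e x s = echain e x t.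
Proof. by elim=> [? ? [-> ->]|//|? ? ? _ -> _]. Qed.

Lemma ehomotopic_catl e x s t t' : echain e x s ->
  ehomotopic e (last x s) t t' -> ehomotopic e x (s ++ t) (s ++ t').
Proof.
move=> cs; elim=> [{}t {}t' [ct ct' l a]|?|? ? ? _ h1 _ h2].
- apply: rt_step; split; rewrite ?/echain ?cat_path ?last_cat //.
  + exact/andP.
  + exact/andP.
  + by case: a => -[s1 [y [s2 [-> ->]]]]; [left|right];
      exists (s ++ s1), y, s2; rewrite !catA.
- exact: rt_refl.
- exact: ehomotopic_trans h1 h2.
Qed.

Lemma ehomotopic_catr e x s s' t : echain e (last x s) t ->
  ehomotopic e x s s' -> ehomotopic e x (s ++ t) (s' ++ t).
Proof.
move=> + h; elim: h => [{}s {}s' [ct ct' l a]|?|a b c h1 IH1 h2 IH2] et.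
- apply: rt_step; split; rewrite ?/echain ?cat_path ?last_cat ?l //.
  + by apply/andP; split => //; rewrite -l.
  + by apply/andP; split => //; rewrite -l.
  + by case: a => -[s1 [y [s2 [-> ->]]]]; [left|right];
      exists s1, y, (s2 ++ t); rewrite -!catA.
- exact: rt_refl.
- apply: ehomotopic_trans (IH1 et) (IH2 _).
  by rewrite -(ehomotopic_last h1).
Qed.

Lemma ehomotopic_cat e x s s' t t' :
  echain e x s -> echain e (last x s) t ->
  ehomotopic e x s s' -> ehomotopic e (last x s) t t' ->
  ehomotopic e x (s ++ t) (s' ++ t').
Proof.
move=> cs ct hs ht; apply: (ehomotopic_trans (ehomotopic_catl cs ht)).
by apply: ehomotopic_catr hs; rewrite -(ehomotopic_echain ht).
Qed.

Lemma chain_inv_last x s : last (last x s) (chain_inv x s) = x.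
Proof. by case: s => //= y s; rewrite /chain_inv /= rev_cons last_rcons. Qed.

Lemma chain_invK x s : chain_inv (last x s) (chain_inv x s) = s.
Proof.
rewrite /chain_inv; case/lastP: s => // s y; rewrite last_rcons belast_rcons.
by rewrite rev_cons belast_rcons rev_cons revK.
Qed.

Lemma echain_inv e x s : echain e (last x s) (chain_inv x s) = echain e x s.
Proof.
rewrite /echain /chain_inv rev_path; apply: eq_path => y z.
exact: eclose_sym.
Qed.

Lemma chain_inv_cat x s t :
  chain_inv x (s ++ t) = chain_inv (last x s) t ++ chain_inv x s.
Proof. by rewrite /chain_inv belast_cat rev_cat. Qed.

Lemma chain_inv_cons x y s : chain_inv x (y :: s) = rcons (chain_inv y s) x.
Proof. by rewrite /chain_inv /= rev_cons. Qed.

Lemma rev_chain x s : rev (x :: s) = last x s :: chain_inv x s.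
Proof. by rewrite /chain_inv lastI rev_rcons. Qed.

Lemma adds_point_rev x s s' : last x s = last x s' -> adds_point s s' ->
  adds_point (chain_inv x s) (chain_inv x s').
Proof.
move=> l [s1 [y [s2 [es es']]]]; subst s s'.
case/lastP: s2 l => [|s2 z] l.
  rewrite cats0 last_cat /= in l.
  exists [::], (last x s1), (chain_inv x s1); rewrite cats0; split => //.
  by rewrite chain_inv_cat.
have -> : chain_inv x (s1 ++ rcons s2 z) = rev s2 ++ rev (x :: s1).
  by rewrite /chain_inv -rcons_cat belast_rcons -cat_cons rev_cat.
have -> : chain_inv x (s1 ++ y :: rcons s2 z) = rev s2 ++ y :: rev (x :: s1).
  rewrite /chain_inv -rcons_cons -rcons_cat belast_rcons -cat_cons rev_cat.
  by rewrite rev_cons cat_rcons.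
by exists (rev s2), y, (rev (x :: s1)).
Qed.

Lemma ehomotopic_inv e x s s' : ehomotopic e x s s' ->
  ehomotopic e (last x s) (chain_inv x s) (chain_inv x s').
Proof.
elim=> [{}s {}s' [ct ct' l a]|?|a b c h1 IH1 h2 IH2].
- apply: rt_step; split; rewrite ?echain_inv //.
  + by rewrite l echain_inv.
  + by rewrite chain_inv_last l chain_inv_last.
  + by case: a => a; [left|right]; apply: adds_point_rev.
- exact: rt_refl.
- apply: ehomotopic_trans IH1 _.
  by rewrite (ehomotopic_last h1).
Qed.

Lemma ehomotopic_drop e x s1 y s2 : echain e x (s1 ++ y :: s2) ->
  echain e x (s1 ++ s2) -> last x (s1 ++ y :: s2) = last x (s1 ++ s2) ->
  ehomotopic e x (s1 ++ y :: s2) (s1 ++ s2).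
Proof.
by move=> c1 c2 l; apply: rt_step; split => //; right; exists s1, y, s2.
Qed.

Lemma ehomotopic_mulV e x s : echain e x s ->
  ehomotopic e x (s ++ chain_inv x s) [::].
Proof.
elim/last_ind: s => [_|s y IH]; first exact: rt_refl.
rewrite /echain rcons_path => /andP[cs cy].
have civ : path (eclose e) (last x s) (chain_inv x s).
  by have := echain_inv e x s; rewrite /echain cs.
have -> : rcons s y ++ chain_inv x (rcons s y) =
          s ++ y :: last x s :: chain_inv x s.
  by rewrite cat_rcons /chain_inv belast_rcons rev_chain.
apply: ehomotopic_trans (IH cs).
apply: (@ehomotopic_trans _ _ _ (s ++ last x s :: chain_inv x s)).
  apply: ehomotopic_drop; rewrite ?/echain ?cat_path ?last_cat //=.
    by rewrite cs cy eclose_sym cy civ.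
  by rewrite cs eclose_refl civ.
apply: ehomotopic_drop; rewrite ?/echain ?cat_path ?last_cat //=.
  by rewrite cs eclose_refl civ.
by rewrite cs civ.
Qed.

Lemma ehomotopic_Vmul e x s : echain e x s ->
  ehomotopic e (last x s) (chain_inv x s ++ s) [::].
Proof.
rewrite -echain_inv => /ehomotopic_mulV.
by rewrite chain_invK.
Qed.

Lemma chain_length_cons x y s :
  chain_length x (y :: s) = mdist x y + chain_length y s.
Proof. by rewrite /chain_length /= big_cons. Qed.

Lemma chain_length_cat x s t :
  chain_length x (s ++ t) = chain_length x s + chain_length (last x s) t.
Proof.
elim: s x => [|y s IH] x; first by rewrite /chain_length /= big_nil add0r.
by rewrite cat_cons !chain_length_cons IH addrA.
Qed.

Lemma chain_length_inv x s :
  chain_length (last x s) (chain_inv x s) = chain_length x s.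
Proof.
elim: s x => [|y s IH] x //.
rewrite chain_inv_cons -cats1 /= chain_length_cat chain_inv_last IH.
by rewrite !chain_length_cons /chain_length /= big_nil addr0 metric_sym addrC.
Qed.

Lemma chain_length_ge0 x s : 0 <= chain_length x s.
Proof. by apply: sumr_ge0 => i _; exact: mdist_ge0. Qed.

Lemma chain_length_mdist x s : mdist x (last x s) <= chain_length x s.
Proof.
elim: s x => [|y s IH] x; first by rewrite mdistxx chain_length_ge0.
rewrite chain_length_cons; apply: le_trans (metric_triangle x y _) _.
by rewrite lerD2l IH.
Qed.

Lemma ehomotopic_short e x s y : echain e x (rcons s y) ->
  chain_length x (rcons s y) < e%:num ->
  ehomotopic e x (rcons s y) [:: y].
Proof.
elim: s => [|z s IH] c l; first exact: rt_refl.
have l' : chain_length x (rcons s y) <= chain_length x (rcons (z :: s) y).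
  rewrite rcons_cons; case: (rcons s y) => [|w u].
    by rewrite [leLHS]/chain_length big_nil chain_length_ge0.
  rewrite !chain_length_cons addrA lerD2r.
  exact: metric_triangle.
have c' : echain e x (rcons s y).
  move: c l => /=; rewrite /echain.
  case E : (rcons s y) => [//|w u] /= /and3P[_ _ ->].
  rewrite andbT /eclose !chain_length_cons addrA => h.
  apply: le_lt_trans (metric_triangle x z w) _.
  by apply: le_lt_trans h; rewrite lerDl chain_length_ge0.
apply: ehomotopic_trans (IH c' (le_lt_trans l' l)).
apply: (@ehomotopic_drop e x [::]) => //=.
by rewrite !last_rcons.
Qed.

Lemma ehomotopic_short_loop e x s : echain e x s -> last x s = x ->
  chain_length x s < e%:num -> ehomotopic e x s [::].
Proof.
case/lastP: s => [_ _ _|s y]; first exact: rt_refl.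
rewrite last_rcons => + yx; rewrite {y}yx => c /(ehomotopic_short c) h.
apply: (ehomotopic_trans h); apply: (@ehomotopic_drop e x [::]) => //=.
by rewrite /echain /= eclose_refl.
Qed.

Record echain_from e x := EChainFrom {
  echain_val :> seq X ;
  echain_valP : echain e x echain_val }.

HB.instance Definition _ e x := [isSub for @echain_val e x].
HB.instance Definition _ e x := [Choice of echain_from e x by <:].

Definition echain_from_rel e x : rel (echain_from e x) :=
  fun c d => `[< ehomotopic e x c d >].

Lemma echain_from_rel_refl e x : reflexive (@echain_from_rel e x).
Proof. by move=> c; apply/asboolP; exact: ehomotopic_refl. Qed.
Lemma echain_from_rel_sym e x : symmetric (@echain_from_rel e x).
Proof. by move=> c d; apply/asboolP/asboolP; exact: ehomotopic_sym. Qed.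
Lemma echain_from_rel_trans e x : transitive (@echain_from_rel e x).
Proof.
move=> c d f /asboolP h1 /asboolP h2; apply/asboolP.
exact: ehomotopic_trans h1 h2.
Qed.

Canonical echain_from_equiv e x := EquivRel (@echain_from_rel e x)
  (@echain_from_rel_refl e x) (@echain_from_rel_sym e x)
  (@echain_from_rel_trans e x).

Record echain_loop e x := EChainLoop {
  eloop_val :> seq X ;
  eloop_valP : echain e x eloop_val && (last x eloop_val == x) }.

HB.instance Definition _ e x := [isSub for @eloop_val e x].
HB.instance Definition _ e x := [Choice of echain_loop e x by <:].

Definition echain_loop_rel e x : rel (echain_loop e x) :=
  fun c d => `[< ehomotopic e x c d >].

Lemma echain_loop_rel_refl e x : reflexive (@echain_loop_rel e x).
Proof. by move=> c; apply/asboolP; exact: ehomotopic_refl. Qed.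
Lemma echain_loop_rel_sym e x : symmetric (@echain_loop_rel e x).
Proof. by move=> c d; apply/asboolP/asboolP; exact: ehomotopic_sym. Qed.
Lemma echain_loop_rel_trans e x : transitive (@echain_loop_rel e x).
Proof.
move=> c d f /asboolP h1 /asboolP h2; apply/asboolP.
exact: ehomotopic_trans h1 h2.
Qed.

Canonical echain_loop_equiv e x := EquivRel (@echain_loop_rel e x)
  (@echain_loop_rel_refl e x) (@echain_loop_rel_sym e x)
  (@echain_loop_rel_trans e x).

End Chains.

Definition Xeps {R : realType} {X : metricType R} (e : {posnum R}) (pt : X) :=
  {eq_quot (@echain_from_equiv R X e pt)}.

Section Xeps.
Context {R : realType} {X : metricType R} (e : {posnum R}) (pt : X).
Local Notation Xe := (Xeps e pt).

HB.instance Definition _ := Choice.on Xe.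
HB.instance Definition _ := EqQuotient.on Xe.

Definition endpoint (a : Xe) : X := last pt (repr a).

(* With alpha := repr a and beta := repr b, the infimum of the lengths of the
   eps-chains in [alpha^-1 beta]_eps, which start at endpoint a. *)
Definition epsdist (a b : Xe) : R :=
  inf [set chain_length (endpoint a) s | s in
    ehomotopic e (endpoint a) (chain_inv pt (repr a) ++ repr b)].

Lemma Xeps_eqP (c d : echain_from e pt) :
  \pi_Xe c = \pi_Xe d <-> ehomotopic e pt c d.
Proof.
split; first by move=> /eqmodP /asboolP.
by move=> h; apply/eqmodP/asboolP.
Qed.

Lemma Xeps_repr (c : echain_from e pt) : ehomotopic e pt (repr (\pi_Xe c)) c.
Proof. by apply/Xeps_eqP; rewrite reprK. Qed.

Lemma endpointE (c : echain_from e pt) : endpoint (\pi_Xe c) = last pt c.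
Proof. exact: ehomotopic_last (Xeps_repr c). Qed.

Let loopset (a b : Xe) := [set chain_length (endpoint a) s | s in
    ehomotopic e (endpoint a) (chain_inv pt (repr a) ++ repr b)].

Let loopset_ge0 a b : lbound (loopset a b) 0.
Proof. by move=> _ [s _ <-]; exact: chain_length_ge0. Qed.

Let loopset_inf a b : has_inf (loopset a b).
Proof.
split; last by exists 0; exact: loopset_ge0.
exists (chain_length (endpoint a) (chain_inv pt (repr a) ++ repr b)).
by exists (chain_inv pt (repr a) ++ repr b) => //; exact: ehomotopic_refl.
Qed.

Let epsdist_ge0 a b : 0 <= epsdist a b.
Proof.
apply: lb_le_inf; first by case: (loopset_inf a b).
exact: loopset_ge0.
Qed.

Let echain_invcat (a b : Xe) :
  echain e (endpoint a) (chain_inv pt (repr a) ++ repr b).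
Proof.
rewrite /echain cat_path /endpoint chain_inv_last.
apply/andP; split; last exact: echain_valP.
by have := echain_inv e pt (repr a); rewrite /echain => ->; exact: echain_valP.
Qed.

Lemma epsdistxx a : epsdist a a = 0.
Proof.
apply/eqP; rewrite eq_le epsdist_ge0 andbT.
apply: ge_inf; first by case: (loopset_inf a a).
exists [::]; last by rewrite /chain_length /= big_nil.
exact/ehomotopic_Vmul/echain_valP.
Qed.

Lemma epsdist_positivity a b : epsdist a b = 0 -> a = b.
Proof.
move=> ab0.
have [_ [s hs <-]] := @inf_adherent _ _ e%:num (gt0 e) (loopset_inf a b).
rewrite -/(epsdist a b) ab0 add0r => ls.
have ls' := ehomotopic_last hs.
rewrite last_cat /endpoint chain_inv_last in ls'.
have eab : endpoint a = endpoint b.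
  apply: mdist_positivity; apply/eqP; rewrite eq_le mdist_ge0 andbT -ab0.
  apply: lb_le_inf; first by case: (loopset_inf a b).
  move=> _ [t ht <-].
  have := chain_length_mdist (endpoint a) t.
  by rewrite -(ehomotopic_last ht) last_cat /endpoint chain_inv_last.
have cs : echain e (endpoint a) s by rewrite -(ehomotopic_echain hs).
have h0 : ehomotopic e (endpoint a) s [::].
  by apply: ehomotopic_short_loop; rewrite // -ls' -/(endpoint b) -eab.
have h1 := ehomotopic_trans hs h0.
rewrite -[a]reprK -[b]reprK; apply/Xeps_eqP.
have ca := echain_valP (repr a).
have cb := echain_valP (repr b).
have := ehomotopic_catl ca h1; rewrite cats0 catA => h2.
apply: ehomotopic_sym; apply: ehomotopic_trans h2.
apply: ehomotopic_sym.
have : ehomotopic e pt ((repr a ++ chain_inv pt (repr a)) ++ repr b)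
         ([::] ++ repr b).
  apply: ehomotopic_catr; last exact: ehomotopic_mulV.
  by rewrite last_cat chain_inv_last.
by [].
Qed.

Let epsdist_le_sym a b : epsdist a b <= epsdist b a.
Proof.
apply: lb_le_inf; first by case: (loopset_inf b a).
move=> _ [s hs <-].
have l := ehomotopic_last hs.
rewrite last_cat /endpoint chain_inv_last -/(endpoint b) in l.
apply: ge_inf; first by case: (loopset_inf a b).
exists (chain_inv (endpoint b) s); last first.
  by rewrite {1}/endpoint l chain_length_inv.
have := ehomotopic_inv hs.
rewrite last_cat /endpoint chain_inv_last chain_inv_cat chain_inv_last.
by rewrite chain_invK.
Qed.

Lemma epsdist_sym a b : epsdist a b = epsdist b a.
Proof. by apply/eqP; rewrite eq_le !epsdist_le_sym. Qed.

Lemma epsdist_triangle b a c : epsdist a c <= epsdist a b + epsdist b c.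
Proof.
apply/ler_addgt0Pr => d d0.
have d20 : 0 < d / 2 by rewrite divr_gt0.
have [_ [s hs <-] ls] := @inf_adherent _ _ _ d20 (loopset_inf a b).
have [_ [t ht <-] lt] := @inf_adherent _ _ _ d20 (loopset_inf b c).
have el := ehomotopic_last hs.
rewrite last_cat /endpoint chain_inv_last -/(endpoint a) -/(endpoint b) in el.
apply: (@le_trans _ _ (chain_length (endpoint a) (s ++ t))); last first.
  rewrite chain_length_cat -el [d]splitr addrACA.
  by apply: lerD; exact: ltW.
apply: ge_inf; first by case: (loopset_inf a c).
exists (s ++ t) => //.
have hst : ehomotopic e (endpoint a)
   ((chain_inv pt (repr a) ++ repr b) ++ (chain_inv pt (repr b) ++ repr c))
   (s ++ t).
  have lab : last (endpoint a) (chain_inv pt (repr a) ++ repr b) = endpoint b.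
    by rewrite last_cat /endpoint chain_inv_last.
  by apply: ehomotopic_cat; rewrite ?lab //; exact: echain_invcat.
apply: ehomotopic_trans hst; apply: ehomotopic_sym.
have -> : (chain_inv pt (repr a) ++ repr b) ++ (chain_inv pt (repr b) ++ repr c)
  = chain_inv pt (repr a) ++ ((repr b ++ chain_inv pt (repr b)) ++ repr c).
  by rewrite -!catA.
apply: ehomotopic_catl.
  by rewrite echain_inv; exact: echain_valP.
rewrite chain_inv_last.
apply: (@ehomotopic_catr _ X e pt _ [::]).
  by rewrite last_cat chain_inv_last; exact: echain_valP.
exact/ehomotopic_mulV/echain_valP.
Qed.

HB.instance Definition _ := isMetric.Build R Xe
  epsdistxx epsdist_positivity epsdist_sym epsdist_triangle.

End Xeps.

Definition pieps {R : realType} {X : metricType R} (e : {posnum R}) (pt : X) :=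
  {eq_quot (@echain_loop_equiv R X e pt)}.

Section PiEps.
Context {R : realType} {X : metricType R} (e : {posnum R}) (pt : X).
Local Notation pie := (pieps e pt).
Implicit Types (c d : echain_loop e pt) (a b : pie).

HB.instance Definition _ := Choice.on pie.
HB.instance Definition _ := EqQuotient.on pie.

Lemma eloop_echain c : echain e pt c.
Proof. by case: c => s /= /andP[]. Qed.

Lemma eloop_last c : last pt c = pt.
Proof. by case: c => s /= /andP[_ /eqP]. Qed.

Lemma eloop_cat_subproof c d :
  echain e pt (c ++ d) && (last pt (c ++ d) == pt).
Proof.
rewrite /echain cat_path last_cat eloop_last eloop_last eqxx andbT.
by apply/andP; split; exact: eloop_echain.
Qed.

Lemma eloop_inv_subproof c :
  echain e pt (chain_inv pt c) && (last pt (chain_inv pt c) == pt).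
Proof.
have := echain_inv e pt c; have := chain_inv_last pt c.
by rewrite eloop_last => -> ->; rewrite eqxx eloop_echain.
Qed.

Lemma eloop_nil_subproof : echain e pt [::] && (last pt [::] == pt).
Proof. exact: eqxx. Qed.

Definition eloop_cat c d := EChainLoop (eloop_cat_subproof c d).
Definition eloop_inv c := EChainLoop (eloop_inv_subproof c).
Definition eloop_nil := EChainLoop eloop_nil_subproof.

Lemma pieps_eqP c d : \pi_pie c = \pi_pie d <-> ehomotopic e pt c d.
Proof.
split; first by move=> /eqmodP /asboolP.
by move=> h; apply/eqmodP/asboolP.
Qed.

Lemma pieps_repr c : ehomotopic e pt (repr (\pi_pie c)) c.
Proof. by apply/pieps_eqP; rewrite reprK. Qed.

Definition pieps_one : pie := \pi_pie eloop_nil.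
Definition pieps_mul a b : pie := \pi_pie (eloop_cat (repr a) (repr b)).
Definition pieps_inv a : pie := \pi_pie (eloop_inv (repr a)).

Lemma pieps_mulE c d :
  pieps_mul (\pi_pie c) (\pi_pie d) = \pi_pie (eloop_cat c d).
Proof.
apply/pieps_eqP; apply: ehomotopic_cat; rewrite ?eloop_last.
- exact: eloop_echain.
- exact: eloop_echain.
- exact: pieps_repr.
- exact: pieps_repr.
Qed.

Lemma pieps_invE c : pieps_inv (\pi_pie c) = \pi_pie (eloop_inv c).
Proof.
apply/pieps_eqP; have := ehomotopic_inv (pieps_repr c).
by rewrite eloop_last.
Qed.

Lemma pieps_ind (P : pie -> Prop) : (forall c, P (\pi_pie c)) -> forall a, P a.
Proof. by move=> h a; rewrite -[a]reprK. Qed.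

Lemma pieps_mulA : associative pieps_mul.
Proof.
elim/pieps_ind=> c; elim/pieps_ind=> d; elim/pieps_ind=> f.
rewrite !pieps_mulE; congr (\pi_pie _); apply: val_inj; exact: catA.
Qed.

Lemma pieps_mul1 : left_id pieps_one pieps_mul.
Proof.
by elim/pieps_ind=> c; rewrite pieps_mulE; congr (\pi_pie _); exact: val_inj.
Qed.

Lemma pieps_mulr1 : right_id pieps_one pieps_mul.
Proof.
elim/pieps_ind=> c; rewrite pieps_mulE; congr (\pi_pie _); apply: val_inj.
exact: cats0.
Qed.

Lemma pieps_mulV : left_inverse pieps_one pieps_inv pieps_mul.
Proof.
elim/pieps_ind=> c; rewrite pieps_invE pieps_mulE; apply/pieps_eqP => /=.
by have := ehomotopic_Vmul (eloop_echain c); rewrite eloop_last.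
Qed.

Lemma pieps_mulrV : right_inverse pieps_one pieps_inv pieps_mul.
Proof.
elim/pieps_ind=> c; rewrite pieps_invE pieps_mulE; apply/pieps_eqP => /=.
exact/ehomotopic_mulV/eloop_echain.
Qed.

HB.instance Definition _ := isGroup.Build pie
  pieps_mulA pieps_mul1 pieps_mulr1 pieps_mulV pieps_mulrV.

End PiEps.

Section Paths.
Context {R : realType}.

Definition is_path {T : topologicalType} (a b : R) (f : R -> T) : Prop :=
  a < b /\ {within `[a, b], continuous f}.

Definition path_loop {T : topologicalType} (a b : R) (f : R -> T) : Prop :=
  is_path a b f /\ f a = f b.

Definition curve_length {X : metricType R} (a b : R) (f : R -> X) : \bar R :=
  ereal_sup [set (chain_length (f a) (map f s))%:E | s in itv_partition a b].

Definition geodesic_space (X : metricType R) : Prop :=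
  forall x y : X, exists a b (f : R -> X),
    [/\ is_path a b f, f a = x, f b = y
      & curve_length a b f = (mdist x y)%:E].

(* The partition a < s_0 < ... < s_n = b stands for the chain (f a, map f s). *)
Definition strong_echain {X : metricType R} (e : {posnum R}) (a b : R)
    (f : R -> X) (s : seq R) : Prop :=
  itv_partition a b s /\
  forall i, (i < size s)%N ->
    let t := nth b (a :: s) i in let t' := nth b s i in
    f @` `[t, t'] `<=` ball (f t) e%:num `&` ball (f t') e%:num.

End Paths.

Section Pi1.
Context {R : realType} {X : metricType R} (pt : X).

Record loop_at := LoopAt {
  loop_val :> R -> X ;
  loop_path : is_path 0 1 loop_val ;
  loop0 : loop_val 0 = pt ;
  loop1 : loop_val 1 = pt }.

HB.instance Definition _ := gen_eqMixin loop_at.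
HB.instance Definition _ := gen_choiceMixin loop_at.

Definition path_homotopic (f g : R -> X) : Prop :=
  exists H : R * R -> X,
    [/\ {within `[0, 1] `*` `[0, 1], continuous H},
        {in `[0, 1], forall s, H (s, 0) = f s},
        {in `[0, 1], forall s, H (s, 1) = g s}
      & {in `[0, 1], forall t, H (0, t) = pt /\ H (1, t) = pt}].

Definition path_cat (f g : R -> X) : R -> X :=
  fun t => if t <= 1 / 2 then f (2 * t) else g (2 * t - 1).

Definition path_inv (f : R -> X) : R -> X := fun t => f (1 - t).

Lemma within_comp (T U V : topologicalType) (A : set T) (B : set U)
    (f : T -> U) (g : U -> V) :
  {within A, continuous f} -> (forall x, A x -> B (f x)) ->
  {within B, continuous g} -> {within A, continuous (g \o f)}.
Proof.
move=> /subspace_continuousP cf AB /subspace_continuousP cg.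
apply/subspace_continuousP => x Ax.
apply: (cvg_trans _ (cg _ (AB _ Ax))) => W /= gW.
have := cf x Ax _ gW; rewrite /= !nbhs_simpl /within /=.
by apply: filterS => y h Ay; exact: h (AB _ Ay).
Qed.

Lemma closed_preimage (T U : topologicalType) (f : T -> U) (C : set U) :
  continuous f -> closed C -> closed (f @^-1` C).
Proof. by move=> /continuous_closedP; apply. Qed.

Lemma within_paste (T U : topologicalType) (A : set T) (c : T -> R)
    (f g : T -> U) : closed A -> continuous c ->
  {within A `&` [set x | c x <= 1 / 2], continuous f} ->
  {within A `&` [set x | 1 / 2 <= c x], continuous g} ->
  (forall x, A x -> c x = 1 / 2 -> f x = g x) ->
  {within A, continuous (fun x => if c x <= 1 / 2 then f x else g x)}.
Proof.
move=> cA cc cf cg fg.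
have -> : A = (A `&` [set x | c x <= 1 / 2]) `|` (A `&` [set x | 1 / 2 <= c x]).
  rewrite -setIUr; apply/seteqP; split => [x Ax|x []//]; split => //=.
  by case: (leP (c x) (1 / 2)) => h; [left|right] => //; exact: ltW.
apply: withinU_continuous.
- apply: closedI => //; have := closed_preimage cc (@closed_le R (1 / 2)).
  exact.
- apply: closedI => //; have := closed_preimage cc (@closed_ge R (1 / 2)).
  exact.
- apply: subspace_eq_continuous cf => x; rewrite inE => -[_ /= h].
  by rewrite /from_subspace h.
- apply: subspace_eq_continuous cg => x; rewrite inE => -[Ax /= h].
  by rewrite /from_subspace; case: leP => // h'; rewrite fg //; apply/eqP; rewrite eq_le h h'.
Qed.

Let I01 : set R := `[0, 1].
Let sq : set (R * R) := `[0, 1] `*` `[0, 1].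

Let closed_I01 : closed I01. Proof. exact: itv_closed. Qed.
Let closed_sq : closed sq.
Proof.
have -> : sq = (fst @^-1` I01) `&` (snd @^-1` I01) by [].
by apply: closedI; apply: closed_preimage => // x; [exact: cvg_fst|exact: cvg_snd].
Qed.

Let I01P (t : R) : I01 t <-> 0 <= t /\ t <= 1.
Proof. by rewrite /I01 /= in_itv /=; split => [/andP|/andP]. Qed.

Let sqP (x : R * R) :
  sq x <-> [/\ 0 <= x.1, x.1 <= 1, 0 <= x.2 & x.2 <= 1].
Proof.
rewrite /sq /= !in_itv /=; split => [[/andP[? ?] /andP[? ?]]|[-> -> -> ->]] //.
Qed.

Let fstc : continuous (fst : R * R -> R). Proof. by move=> x; exact: cvg_fst. Qed.
Let sndc : continuous (snd : R * R -> R). Proof. by move=> x; exact: cvg_snd. Qed.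

Let cont_pair (T : topologicalType) (f g : T -> R) (x : T) :
  {for x, continuous f} -> {for x, continuous g} ->
  {for x, continuous (fun y => (f y, g y))}.
Proof. by move=> cf cg; exact: (cvg_pair cf cg). Qed.

Let two1 : 2 * 1 - 1 = 1 :> R.
Proof. by rewrite mulr1 addrK. Qed.

Lemma path_homotopic_refl (f : loop_at) : path_homotopic f f.
Proof.
exists (f \o fst); split => //=.
- apply: (@within_comp _ _ _ sq I01).
  + by apply: continuous_subspaceT => x; exact: fstc.
  + by move=> x [].
  + by case: (loop_path f).
- by move=> t _; rewrite loop0 loop1.
Qed.

Lemma path_homotopic_sym f g : path_homotopic f g -> path_homotopic g f.
Proof.
move=> [H [cH H0 H1 Hb]]; exists (H \o (fun x => (x.1, 1 - x.2))); split => /=.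
- apply: (@within_comp _ _ _ sq sq) => //.
  + apply: continuous_subspaceT => x; apply: cont_pair; first exact: fstc.
    by apply: cvgB; [exact: cvg_cst|exact: sndc].
  + by move=> x /sqP[? ? ? ?]; apply/sqP; split => //=; lra.
- by move=> s h; rewrite subr0 H1.
- by move=> s h; rewrite subrr H0.
- move=> t; rewrite in_itv /= => /andP[? ?]; apply: Hb.
  by rewrite in_itv /=; apply/andP; split; lra.
Qed.

Lemma path_homotopic_trans g f h :
  path_homotopic f g -> path_homotopic g h -> path_homotopic f h.
Proof.
move=> [H [cH H0 H1 Hb]] [K [cK K0 K1 Kb]].
exists (fun x => if x.2 <= 1 / 2 then (H \o (fun x => (x.1, 2 * x.2))) x
                 else (K \o (fun x => (x.1, 2 * x.2 - 1))) x); split => /=.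
- apply: (@within_paste _ _ sq snd _ _ closed_sq sndc).
  + apply: (@within_comp _ _ _ _ sq) => //.
      apply: continuous_subspaceT => x; apply: cont_pair; first exact: fstc.
      by apply: cvgM; [exact: cvg_cst|exact: sndc].
    by move=> x [/sqP[? ? ? ?] /= ?]; apply/sqP; split => //=; lra.
  + apply: (@within_comp _ _ _ _ sq) => //.
      apply: continuous_subspaceT => x; apply: cont_pair; first exact: fstc.
      apply: cvgB; last exact: cvg_cst.
      by apply: cvgM; [exact: cvg_cst|exact: sndc].
    by move=> x [/sqP[? ? ? ?] /= ?]; apply/sqP; split => //=; lra.
  + move=> x /sqP[? ? ? ?] /= ->.
    have -> : 2 * (1 / 2) = 1 :> R by lra.
    by rewrite subrr H1 ?K0 // in_itv /=; apply/andP; split.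
- by move=> s hs; rewrite ifT ?mulr0 ?H0 //; lra.
- move=> s hs; rewrite ifF; last by apply/negbTE; rewrite -ltNge; lra.
  by rewrite two1; rewrite K1.
- move=> t; rewrite in_itv /= => /andP[? ?]; case: leP => ?.
    by apply: Hb; rewrite in_itv /=; apply/andP; split; lra.
  by apply: Kb; rewrite in_itv /=; apply/andP; split; lra.
Qed.

Lemma path_homotopic_reparam (f : loop_at) (p q : R -> R) (g h : R -> X) :
  continuous p -> continuous q ->
  (forall t, I01 t -> I01 (p t)) -> (forall t, I01 t -> I01 (q t)) ->
  (forall t, I01 t -> g t = f (p t)) -> (forall t, I01 t -> h t = f (q t)) ->
  p 0 = q 0 -> p 1 = q 1 -> g 0 = pt -> g 1 = pt -> path_homotopic g h.
Proof.
move=> cp cq Ip Iq gE hE pq0 pq1 g0 g1.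
exists (f \o (fun x => (1 - x.2) * p x.1 + x.2 * q x.1)); split => /=.
- apply: (@within_comp _ _ _ sq I01).
  + apply: continuous_subspaceT => x; apply: cvgD; apply: cvgM.
    * by apply: cvgB; [exact: cvg_cst|exact: sndc].
    * by apply: (@continuous_comp _ _ _ fst p x); [exact: fstc|exact: cp].
    * exact: sndc.
    * by apply: (@continuous_comp _ _ _ fst q x); [exact: fstc|exact: cq].
  + move=> x /sqP[x1 x2 x3 x4]; apply/I01P.
    have /I01P[? ?] : I01 (p x.1) by apply/Ip/I01P.
    have /I01P[? ?] : I01 (q x.1) by apply/Iq/I01P.
    by split; nra.
  + by case: (loop_path f).
- by move=> s hs; rewrite subr0 mul1r mul0r addr0 -gE.
- by move=> s hs; rewrite subrr mul0r mul1r add0r -hE.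
- move=> t _; rewrite -pq0 -pq1 -!mulrDl subrK !mul1r.
  by rewrite -!gE ?g0 ?g1 //; apply/I01P.
Qed.

Lemma path_cat_subproof (f g : loop_at) : is_path 0 1 (path_cat f g).
Proof.
split => //; apply: (@within_paste _ _ I01 id (fun t => f (2 * t))
  (fun t => g (2 * t - 1)) closed_I01 (fun=> cvg_id)).
- apply: (@within_comp R R X (I01 `&` [set x | id x <= 1 / 2]) I01
    (fun t => 2 * t) f).
  + by apply: continuous_subspaceT => x; exact: mulrl_continuous.
  + by move=> t [/I01P[? ?] /= ?]; apply/I01P; split; lra.
  + by case: (loop_path f).
- apply: (@within_comp R R X (I01 `&` [set x | 1 / 2 <= id x]) I01
    (fun t => 2 * t - 1) g).
  + apply: continuous_subspaceT => x; apply: cvgB; last exact: cvg_cst.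
    exact: mulrl_continuous.
  + by move=> t [/I01P[? ?] /= ?]; apply/I01P; split; lra.
  + by case: (loop_path g).
- move=> t _ ->; have -> : 2 * (1 / 2) = 1 :> R by lra.
  by rewrite subrr loop0 loop1.
Qed.

Lemma path_cat0 (f g : loop_at) : path_cat f g 0 = pt.
Proof. by rewrite /path_cat ifT ?mulr0 ?loop0 //; lra. Qed.

Lemma path_cat1 (f g : loop_at) : path_cat f g 1 = pt.
Proof.
rewrite /path_cat ifF; last by apply/negbTE; rewrite -ltNge; lra.
by rewrite two1; rewrite loop1.
Qed.

Definition loop_cat (f g : loop_at) : loop_at :=
  LoopAt (path_cat_subproof f g) (path_cat0 f g) (path_cat1 f g).

Lemma path_inv_subproof (f : loop_at) : is_path 0 1 (path_inv f).
Proof.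
split => //; apply: (@within_comp R R X I01 I01 (fun t => 1 - t) f).
- apply: continuous_subspaceT => x.
  by apply: cvgB; [exact: cvg_cst|exact: cvg_id].
- by move=> t /I01P[? ?]; apply/I01P; split; lra.
- by case: (loop_path f).
Qed.

Lemma path_inv0 (f : loop_at) : path_inv f 0 = pt.
Proof. by rewrite /path_inv subr0 loop1. Qed.

Lemma path_inv1 (f : loop_at) : path_inv f 1 = pt.
Proof. by rewrite /path_inv subrr loop0. Qed.

Definition loop_inv (f : loop_at) : loop_at :=
  LoopAt (path_inv_subproof f) (path_inv0 f) (path_inv1 f).

Lemma path_cst_subproof : is_path 0 1 (fun _ : R => pt).
Proof. by split => //; apply: continuous_subspaceT => x; exact: cvg_cst. Qed.

Definition loop_cst : loop_at := LoopAt path_cst_subproof erefl erefl.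

Lemma path_homotopic_cat (f f' g g' : R -> X) :
  path_homotopic f f' -> path_homotopic g g' ->
  path_homotopic (path_cat f g) (path_cat f' g').
Proof.
move=> [H [cH H0 H1 Hb]] [K [cK K0 K1 Kb]].
exists (fun x => if x.1 <= 1 / 2 then (H \o (fun x => (2 * x.1, x.2))) x
                 else (K \o (fun x => (2 * x.1 - 1, x.2))) x); split => /=.
- apply: (@within_paste _ _ sq fst _ _ closed_sq fstc).
  + apply: (@within_comp _ _ _ _ sq) => //.
      apply: continuous_subspaceT => x; apply: (@cont_pair (R * R)%type
        (fun x : R * R => 2 * x.1) snd); last exact: sndc.
      by apply: cvgM; [exact: cvg_cst|exact: fstc].
    by move=> x [/sqP[? ? ? ?] /= ?]; apply/sqP; split => //=; lra.
  + apply: (@within_comp _ _ _ _ sq) => //.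
      apply: continuous_subspaceT => x; apply: (@cont_pair (R * R)%type
        (fun x : R * R => 2 * x.1 - 1) snd); last exact: sndc.
      apply: cvgB; last exact: cvg_cst.
      by apply: cvgM; [exact: cvg_cst|exact: fstc].
    by move=> x [/sqP[? ? ? ?] /= ?]; apply/sqP; split => //=; lra.
  + move=> [x t] /sqP[? ? ? ?] /= ->.
    have ht : t \in `[0, 1] by rewrite in_itv /=; apply/andP; split.
    have -> : 2 * (1 / 2) = 1 :> R by lra.
    by rewrite subrr; case: (Hb t ht) => _ ->; case: (Kb t ht) => ->.
- move=> s; rewrite in_itv /path_cat /= => /andP[? ?]; case: leP => ?.
    by rewrite H0 // in_itv /=; apply/andP; split; lra.
  by rewrite K0 // in_itv /=; apply/andP; split; lra.
- move=> s; rewrite in_itv /path_cat /= => /andP[? ?]; case: leP => ?.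
    by rewrite H1 // in_itv /=; apply/andP; split; lra.
  by rewrite K1 // in_itv /=; apply/andP; split; lra.
- move=> t ht; split.
    by rewrite ifT ?mulr0; [case: (Hb t ht)|lra].
  rewrite ifF; last by apply/negbTE; rewrite -ltNge; lra.
  by rewrite two1; case: (Kb t ht).
Qed.

Lemma path_homotopic_inv (f f' : R -> X) :
  path_homotopic f f' -> path_homotopic (path_inv f) (path_inv f').
Proof.
move=> [H [cH H0 H1 Hb]].
exists (H \o (fun x => (1 - x.1, x.2))); split => /=.
- apply: (@within_comp _ _ _ sq sq) => //.
  + apply: continuous_subspaceT => x; apply: (@cont_pair (R * R)%type
        (fun x : R * R => 1 - x.1) snd); last exact: sndc.
    by apply: cvgB; [exact: cvg_cst|exact: fstc].
  + by move=> x /sqP[? ? ? ?]; apply/sqP; split => //=; lra.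
- move=> s; rewrite in_itv /= => /andP[? ?].
  by rewrite H0 // in_itv /=; apply/andP; split; lra.
- move=> s; rewrite in_itv /= => /andP[? ?].
  by rewrite H1 // in_itv /=; apply/andP; split; lra.
- by move=> t ht; rewrite subr0 subrr; case: (Hb t ht).
Qed.

Let min_cont (p q : R -> R) : continuous p -> continuous q ->
  continuous (fun t => Num.min (p t) (q t)).
Proof. by move=> cp cq x; apply: continuous_min; [exact: cp|exact: cq]. Qed.

Let max_cont (p q : R -> R) : continuous p -> continuous q ->
  continuous (fun t => Num.max (p t) (q t)).
Proof. by move=> cp cq x; apply: continuous_max; [exact: cp|exact: cq]. Qed.

Let aff_cont (a b : R) : continuous (fun t : R => a * t + b).
Proof.
move=> x; apply: cvgD; last exact: cvg_cst.
exact: mulrl_continuous.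
Qed.

Lemma path_catA (f g h : loop_at) :
  path_homotopic (path_cat f (path_cat g h)) (path_cat (path_cat f g) h).
Proof.
pose p (t : R) : R :=
  Num.min (2 * t + 0) (Num.min (1 * t + 1 / 4) (1 / 2 * t + 1 / 2)).
have pE1 t : t <= 1 / 4 -> p t = 2 * t.
  move=> ?; rewrite /p (@min_l _ _ (1 * t + _)); last by lra.
  by rewrite min_l; lra.
have pE2 t : 1 / 4 <= t -> t <= 1 / 2 -> p t = t + 1 / 4.
  move=> ? ?; rewrite /p (@min_l _ _ (1 * t + _)); last by lra.
  by rewrite min_r; lra.
have pE3 t : 1 / 2 <= t -> p t = t / 2 + 1 / 2.
  move=> ?; rewrite /p (@min_r _ _ (1 * t + _)); last by lra.
  by rewrite min_r; lra.
apply: path_homotopic_sym.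
apply: (@path_homotopic_reparam (loop_cat f (loop_cat g h)) p id).
- by apply: min_cont; [|apply: min_cont]; exact: aff_cont.
- by move=> x; exact: cvg_id.
- move=> t /I01P[? ?]; apply/I01P.
  case: (leP t (1 / 4)) => ?; first by rewrite pE1 //; split; lra.
  case: (leP t (1 / 2)) => ?; first by rewrite pE2; [split; lra|lra|lra].
  by rewrite pE3; [split; lra|lra].
- by [].
- move=> t /I01P[? ?]; rewrite /= /path_cat.
  case: (leP t (1 / 4)) => ?.
    rewrite pE1 // ifT; last by lra.
    by rewrite ifT; [rewrite ifT; [|lra]|lra].
  case: (leP t (1 / 2)) => ?.
    rewrite pE2; [|lra|lra].
    rewrite ifF; last by apply/negbTE; rewrite -ltNge; lra.
    rewrite ifF; last by apply/negbTE; rewrite -ltNge; lra.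
    by rewrite ifT; [congr (g _); lra|lra].
  rewrite pE3; [|lra].
  rewrite ifF; last by apply/negbTE; rewrite -ltNge; lra.
  rewrite ifF; last by apply/negbTE; rewrite -ltNge; lra.
  by congr (h _); lra.
- by [].
- by rewrite pE1; lra.
- by rewrite pE3; lra.
- exact: (path_cat0 (loop_cat f g) h).
- exact: (path_cat1 (loop_cat f g) h).
Qed.

Lemma path_cat1f (f : loop_at) : path_homotopic (path_cat loop_cst f) f.
Proof.
apply: (@path_homotopic_reparam f (fun t => Num.max (0 * t + 0) (2 * t + -1)) id).
- by apply: max_cont; exact: aff_cont.
- by move=> x; exact: cvg_id.
- by move=> t /I01P[? ?]; apply/I01P; case: (leP (0 * t + 0) (2 * t + -1)) => ?; split; lra.
- by [].
- move=> t /I01P[? ?]; rewrite /path_cat /=.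
  case: (leP t (1 / 2)) => ?; case: (leP (0 * t + 0) (2 * t + -1)) => ?; rewrite -?[in LHS](loop0 f);
    by congr (f _); lra.
- by [].
- by case: leP => ?; lra.
- by case: leP => ?; lra.
- exact: path_cat0.
- exact: path_cat1.
Qed.

Lemma path_catf1 (f : loop_at) : path_homotopic (path_cat f loop_cst) f.
Proof.
apply: (@path_homotopic_reparam f (fun t => Num.min (2 * t + 0) (0 * t + 1)) id).
- by apply: min_cont; exact: aff_cont.
- by move=> x; exact: cvg_id.
- by move=> t /I01P[? ?]; apply/I01P; case: (leP (2 * t + 0) (0 * t + 1)) => ?; split; lra.
- by [].
- move=> t /I01P[? ?]; rewrite /path_cat /=.
  case: (leP t (1 / 2)) => ?; case: (leP (2 * t + 0) (0 * t + 1)) => ?; rewrite -?[in LHS](loop1 f);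
    by congr (f _); lra.
- by [].
- by case: leP => ?; lra.
- by case: leP => ?; lra.
- exact: path_cat0.
- exact: path_cat1.
Qed.

Lemma path_catfV (f : loop_at) :
  path_homotopic (path_cat f (path_inv f)) loop_cst.
Proof.
apply: (@path_homotopic_reparam f
  (fun t => Num.min (2 * t + 0) (- 2 * t + 2)) (fun=> 0)).
- by apply: min_cont; exact: aff_cont.
- by move=> x; exact: cvg_cst.
- by move=> t /I01P[? ?]; apply/I01P; case: (leP (2 * t + 0) (- 2 * t + 2)) => ?; split; lra.
- by move=> *; apply/I01P.
- move=> t /I01P[? ?]; rewrite /path_cat /path_inv /=.
  by case: (leP t (1 / 2)) => ?; case: (leP (2 * t + 0) (- 2 * t + 2)) => ?; congr (f _); lra.
- by move=> *; rewrite /= loop0.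
- by case: leP => ?; lra.
- by case: leP => ?; lra.
- exact: (path_cat0 f (loop_inv f)).
- exact: (path_cat1 f (loop_inv f)).
Qed.

Lemma path_catVf (f : loop_at) :
  path_homotopic (path_cat (path_inv f) f) loop_cst.
Proof.
apply: (@path_homotopic_reparam f
  (fun t => Num.max (- 2 * t + 1) (2 * t + -1)) (fun=> 1)).
- by apply: max_cont; exact: aff_cont.
- by move=> x; exact: cvg_cst.
- by move=> t /I01P[? ?]; apply/I01P; case: (leP (- 2 * t + 1) (2 * t + -1)) => ?; split; lra.
- by move=> *; apply/I01P.
- move=> t /I01P[? ?]; rewrite /path_cat /path_inv /=.
  by case: (leP t (1 / 2)) => ?; case: (leP (- 2 * t + 1) (2 * t + -1)) => ?; congr (f _); lra.
- by move=> *; rewrite /= loop1.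
- by case: leP => ?; lra.
- by case: leP => ?; lra.
- exact: (path_cat0 (loop_inv f) f).
- exact: (path_cat1 (loop_inv f) f).
Qed.

Definition loop_rel : rel loop_at := fun f g => `[< path_homotopic f g >].

Lemma loop_rel_refl : reflexive loop_rel.
Proof. by move=> f; apply/asboolP; exact: path_homotopic_refl. Qed.
Lemma loop_rel_sym : symmetric loop_rel.
Proof. by move=> f g; apply/asboolP/asboolP; exact: path_homotopic_sym. Qed.
Lemma loop_rel_trans : transitive loop_rel.
Proof.
move=> g f h /asboolP fg /asboolP gh; apply/asboolP.
exact: path_homotopic_trans fg gh.
Qed.

Canonical loop_equiv :=
  EquivRel loop_rel loop_rel_refl loop_rel_sym loop_rel_trans.

Definition pi1 := {eq_quot loop_equiv}.

HB.instance Definition _ := Choice.on pi1.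
HB.instance Definition _ := EqQuotient.on pi1.

Lemma pi1_eqP (f g : loop_at) : \pi_pi1 f = \pi_pi1 g <-> path_homotopic f g.
Proof.
split; first by move=> /eqmodP /asboolP.
by move=> h; apply/eqmodP/asboolP.
Qed.

Lemma pi1_repr (f : loop_at) : path_homotopic (repr (\pi_pi1 f)) f.
Proof. by apply/pi1_eqP; rewrite reprK. Qed.

Definition pi1_one : pi1 := \pi_pi1 loop_cst.
Definition pi1_mul (a b : pi1) : pi1 := \pi_pi1 (loop_cat (repr a) (repr b)).
Definition pi1_inv (a : pi1) : pi1 := \pi_pi1 (loop_inv (repr a)).

Lemma pi1_mulE f g : pi1_mul (\pi_pi1 f) (\pi_pi1 g) = \pi_pi1 (loop_cat f g).
Proof. by apply/pi1_eqP/path_homotopic_cat; exact: pi1_repr. Qed.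

Lemma pi1_invE f : pi1_inv (\pi_pi1 f) = \pi_pi1 (loop_inv f).
Proof. exact/pi1_eqP/path_homotopic_inv/pi1_repr. Qed.

Lemma pi1_ind (P : pi1 -> Prop) : (forall f, P (\pi_pi1 f)) -> forall a, P a.
Proof. by move=> h a; rewrite -[a]reprK. Qed.

Lemma pi1_mulA : associative pi1_mul.
Proof.
elim/pi1_ind=> f; elim/pi1_ind=> g; elim/pi1_ind=> h.
by rewrite !pi1_mulE; apply/pi1_eqP; exact: path_catA.
Qed.

Lemma pi1_mul1 : left_id pi1_one pi1_mul.
Proof.
by elim/pi1_ind=> f; rewrite pi1_mulE; apply/pi1_eqP; exact: path_cat1f.
Qed.

Lemma pi1_mulr1 : right_id pi1_one pi1_mul.
Proof.
by elim/pi1_ind=> f; rewrite pi1_mulE; apply/pi1_eqP; exact: path_catf1.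
Qed.

Lemma pi1_mulV : left_inverse pi1_one pi1_inv pi1_mul.
Proof.
elim/pi1_ind=> f; rewrite pi1_invE pi1_mulE; apply/pi1_eqP.
exact: path_catVf.
Qed.

Lemma pi1_mulrV : right_inverse pi1_one pi1_inv pi1_mul.
Proof.
elim/pi1_ind=> f; rewrite pi1_invE pi1_mulE; apply/pi1_eqP.
exact: path_catfV.
Qed.

HB.instance Definition _ := isGroup.Build pi1
  pi1_mulA pi1_mul1 pi1_mulr1 pi1_mulV pi1_mulrV.

End Pi1.

Section RevisedFundamentalGroup.
Context {R : realType} {X : metricType R} (pt : X).

(* The class of any strong eps-chain along any representative of g. A strong
   chain exists for every loop, by uniform continuity, and its class depends
   only on g, so that the default value 1 is never used. *)
Definition heps (e : {posnum R}) (g : pi1 pt) : pieps e pt :=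
  xget 1%g [set c | exists (f : loop_at pt) (s : seq R) (l : echain_loop e pt),
    [/\ g = \pi_(pi1 pt) f, strong_echain e 0 1 f s,
        l = map f s :> seq X & c = \pi_(pieps e pt) l]].

Definition Keps (e : {posnum R}) : set (pi1 pt) := heps e @^-1` [set 1%g].

Definition pi_cl : set (pi1 pt) := \bigcap_(e in [set: {posnum R}]) Keps e.

(* pi_1(X) / pi_cl(X), as the set of the left cosets of pi_cl(X). *)
Definition pi1bar : set (set (pi1 pt)) :=
  [set [set (g * k)%g | k in pi_cl] | g in [set: pi1 pt]].

End RevisedFundamentalGroup.

Arguments pi_cl {R X} pt.
Arguments pi1bar {R X} pt.

Section Lifts.
Context {R : realType} {X : metricType R} (pt : X).

Definition is_lift (e : {posnum R}) (a b : R) (f : R -> X)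
    (F : R -> Xeps e pt) : Prop :=
  is_path a b F /\ {in `[a, b], forall t, endpoint (F t) = f t}.

Definition lifts_closed (e : {posnum R}) (a b : R) (f : R -> X) : Prop :=
  forall F : R -> Xeps e pt, is_lift a b f F -> F a = F b.

Definition semilocally_r_simply_connected : Prop :=
  forall x : X, exists2 r : R, 0 < r &
    forall a b (f : R -> X), path_loop a b f -> f a = x ->
      f @` `[a, b] `<=` ball x r ->
      forall e : {posnum R}, lifts_closed e a b f.

End Lifts.

(* Main.v *)
Require Import Defs.
From mathcomp Require Import all_boot all_order all_algebra.
From mathcomp Require Import all_classical all_reals all_analysis.
From mathcomp Require Import lra generic_quotient.

(** Suppose that no ball around x has the required property. Then every ball around x contains a path loop that, for some e, does not
    lift closed to X_e. Joining it to x by geodesics yields a loop l based at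
    x, still in the ball, whose strong e-chains are not e-null
    ([bad_loop_exists]).

    Every loop of diameter less than e is e-null. So bad loops l_0, l_1, ...
    at x, with scales e_0, e_1, ..., can be chosen inductively such that any
    concatenation of the l_m with m > n is e_n-null, while l_n is not, and
    such that their diameters tend to 0. The latter makes the infinite
    concatenation of l_0, l_1, ... a continuous loop, and so is the loop L_s
    obtained for s : nat -> bool by replacing with a constant each l_n such
    that s n is false ([infcat]). If n is the first index at which s and s'
    differ, then at scale e_n everything after the n-th piece is invisible,
    and L_s and L_s' differ exactly by the factor l_n; since l_n is not
    e_n-null, they have distinct images under h_(e_n)
    ([infcat_separated]). Once x is joined to the base point by geodesics,
    s |-> L_s thus induces an injection of the uncountable set nat -> bool
    into pi_1(X) / pi_cl(X), against the hypothesis.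

    The computations rest on strong chains. Two strong e-chains along the
    same path are e-homotopic ([strong_unique]), because each of them computes
    the endpoint of one and the same discrete lift of the path
    ([chain_lift_strong]); an honest lift to X_e is such a discrete lift,
    so that lifts are governed by strong chains as well ([lift_strong]).
    Strong chains along homotopic loops are e-homotopic
    ([homotopic_strong]), so h_e can be computed with any strong chain along
    any representative ([heps_strong]). *)

Set Implicit Arguments.
Unset Strict Implicit.
Unset Printing Implicit Defensive.

Import Order.TTheory GRing.Theory Num.Theory.
Import numFieldNormedType.Exports.

Local Open Scope classical_set_scope.
Local Open Scope ring_scope.

(** * Uniform continuity on segments *)

(** Continuity is handled through moduli on segments: unlike continuity
    within a subset, they concern a single e at a time, so that they glue even
    where infinitely many pieces accumulate. *)
Definition uclose {R : realType} {X : metricType R} (e a b : R) (f : R -> X) :=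
  exists2 d, 0 < d & forall u v, a <= u <= b -> a <= v <= b ->
    `|u - v| < d -> mdist (f u) (f v) < e.

Definition ucont {R : realType} {X : metricType R} (a b : R) (f : R -> X) :=
  forall e, 0 < e -> uclose e a b f.

Lemma compact_ucont (R : realType) (T : pseudoMetricType R) (X : metricType R)
    (K : set T) (f : T -> X) : compact K -> {within K, continuous f} ->
  forall e, 0 < e -> exists2 d, 0 < d &
    forall u v, K u -> K v -> ball u d v -> mdist (f u) (f v) < e.
Proof.
move=> /compact_near_coveringP/near_covering_withinP cK.
move=> /subspace_continuousP cf e e0.
have /cK h : forall x, K x -> \forall u \near x & d \near (0:R)^'+,
    K u -> forall v, K v -> ball u d v -> mdist (f u) (f v) < e.
  move=> x Kx.
  have e20 : 0 < e / 2 by lra.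
  have := cf _ Kx (ball (f x) (e / 2)).
  rewrite nbhs_simpl => /(_ (nbhsx_ballx _ _ e20)).
  rewrite /= /within => /nbhs_ballP[d /= d0 hd].
  have d20 : 0 < d / 2 by lra.
  exists (ball x (d / 2), [set d' | 0 < d' < d / 2]) => /=.
    split; first exact: nbhsx_ballx.
    near=> t; apply/andP; split; near: t; first exact: nbhs_right_gt.
    exact: nbhs_right_lt.
  move=> [u d'] /= [xu /andP[d'0 d'd]] Ku v Kv uv.
  have := hd _ (le_ball _ xu) Ku; rewrite ballEmdist /= => /(_ ltac:(lra)) h1.
  have xv : ball x d v.
    rewrite (splitr d); apply: ball_triangle xu _.
    exact: le_ball (ltW d'd) _ uv.
  have := hd _ xv Kv; rewrite ballEmdist /= => h2.
  have := metric_triangle (f u) (f x) (f v);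
    rewrite (metric_sym (f u) (f x)) => h3.
  lra.
have [d [d0 hd]] : exists d, 0 < d /\ forall u, K u -> forall v, K v ->
    ball u d v -> mdist (f u) (f v) < e.
  near (0:R)^'+ => d; exists d; split; first by near: d; exact: nbhs_right_gt.
  by near: d; exact: h.
by exists d => // u v Ku Kv; exact: hd.
Unshelve. all: by end_near. Qed.

Lemma path_ucont (R : realType) (X : metricType R) (a b : R) (f : R -> X) :
  is_path a b f -> ucont a b f.
Proof.
move=> [_ cf] e e0.
have [d d0 h] := compact_ucont (@segment_compact R a b) cf e0.
by exists d => // u v ? ? uv; apply: h; rewrite /= ?in_itv.
Qed.

Lemma ucont_path (R : realType) (X : metricType R) (a b : R) (f : R -> X) :
  a < b -> ucont a b f -> is_path a b f.
Proof.
move=> ab uf; split => //; apply/subspace_continuousP => u uab.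
apply/metricType_numDomainType.cvgrPdist_lt => e e0.
have [d d0 h] := uf e e0.
rewrite near_withinE; apply/nbhs_ballP; exists d => //= v uv vab.
by move: uab vab; rewrite /= !in_itv /= => ? ?; exact: h.
Qed.

(** The uniform step d makes this an archimedean induction, which replaces
    connectedness arguments once a modulus of continuity is known. *)
Lemma step_ind {R : realType} (a b : R) (P : R -> Prop) (d : R) : 0 < d ->
  P a -> (forall u v, a <= u -> u <= v -> v <= b -> v - u < d -> P u -> P v) ->
  forall t, a <= t <= b -> P t.
Proof.
move=> d0 Pa Pst.
have H n : forall t, a <= t <= b -> t <= a + d / 2 *+ n -> P t.
  elim: n => [|n IH] t /andP[ta tb].
    by rewrite mulr0n addr0 => ta'; have -> : t = a by lra.
  rewrite mulrS => tn.
  have [?|?] := leP t (a + d / 2); first by apply: (Pst a) => //; lra.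
  by apply: (Pst (t - d / 2)); try lra; apply: IH; lra.
move=> t tab.
have d20 : 0 < d / 2 by lra.
have [n hn] : exists n : nat, t - a <= d / 2 *+ n.
  have := archi_boundP (divr_ge0 (normr_ge0 (t - a)) (ltW d20)).
  rewrite ltr_pdivrMr // => h; exists (Num.bound (`|t - a| / (d / 2))).
  rewrite -mulr_natl; apply: le_trans (ltW h); exact: ler_norm.
by apply: (H n) => //; lra.
Qed.

(** * Strong chains and discrete lifts *)

Section Chains.
Context {R : realType} {X : metricType R}.
Implicit Types (e : {posnum R}) (x y : X) (a b : R) (f : R -> X).

Lemma ehomotopic_rcons e x (s s' : seq X) y : mdist (last x s) y < e%:num ->
  ehomotopic e x s s' -> ehomotopic e x (rcons s y) (rcons s' y).
Proof.
by rewrite -!cats1 => h; apply: ehomotopic_catr; rewrite /echain /= /eclose h.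
Qed.

Lemma ehomotopic_skip e x (s : seq X) y z : echain e x s ->
  mdist (last x s) y < e%:num -> mdist y z < e%:num ->
  mdist (last x s) z < e%:num ->
  ehomotopic e x (rcons (rcons s y) z) (rcons s z).
Proof.
move=> cs sy yz sz; rewrite -(cats1 s z) -cats1 cat_rcons.
by apply: ehomotopic_drop; rewrite /echain ?cat_path ?last_cat //= /eclose;
  rewrite -/(echain e x s) cs ?sy ?yz ?sz.
Qed.

Lemma ehomotopic_dup e x (s : seq X) : echain e x s ->
  ehomotopic e x (rcons s (last x s)) s.
Proof.
move=> cs; rewrite -cats1 -{3}[s]cats0.
by apply: ehomotopic_drop; rewrite ?cats0 ?last_cat //= /echain cat_path /=
  -/(echain e x s) cs eclose_refl.
Qed.

(** The condition Q on consecutive points is left open: it is strong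
    closeness for a strong chain, a bound on the mesh when one partition has to
    serve several paths at once, and closeness of two rows in a homotopy. *)
Inductive subdivision (Q : R -> R -> Prop) : R -> R -> list R -> Prop :=
| subdivision_nil a : subdivision Q a a [::]
| subdivision_cons a t b (s : seq R) : a < t -> Q a t -> subdivision Q t b s ->
    subdivision Q a b (t :: s).

Lemma subdivision_le Q a b s : subdivision Q a b s -> a <= b.
Proof. by elim=> // {}a t {}b {}s /ltW at_ _ _; exact: le_trans. Qed.

Lemma subdivision_last Q a b s : subdivision Q a b s -> last a s = b.
Proof. by elim. Qed.

Lemma subdivision_cat Q a b c s t :
  subdivision Q a b s -> subdivision Q b c t -> subdivision Q a c (s ++ t).
Proof. by elim=> // {}a u {}b {}s au Qau _ IH /IH; exact: subdivision_cons. Qed.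

Lemma subdivision_impl (Q Q' : R -> R -> Prop) a b s :
  (forall u v, a <= u -> u < v -> v <= b -> Q u v -> Q' u v) ->
  subdivision Q a b s -> subdivision Q' a b s.
Proof.
move=> + h; elim: h => [{}a _|{}a t {}b {}s at_ Qat h IH QQ'].
  exact: subdivision_nil.
have tb := subdivision_le h.
apply: subdivision_cons => //; first exact: QQ' (lexx a) at_ tb Qat.
by apply: IH => u v tu; apply: QQ'; exact: le_trans (ltW at_) tu.
Qed.

Lemma subdivision_exists (Q : R -> R -> Prop) a b d : 0 < d -> a <= b ->
  (forall u v, a <= u -> u < v -> v <= b -> v - u < d -> Q u v) ->
  exists s, subdivision Q a b s.
Proof.
move=> d0 ab H.
apply: (@step_ind R a b (fun v => exists s, subdivision Q a v s) d d0);
  last by lra.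
  by exists [::]; exact: subdivision_nil.
move=> u v au uv vb vu [s hs].
move: uv; rewrite le_eqVlt => /predU1P[<-|uv]; first by exists s.
exists (s ++ [:: v]); apply: (subdivision_cat hs).
by apply: subdivision_cons => //; [exact: H|exact: subdivision_nil].
Qed.

Definition strongly_close e f u v : Prop :=
  forall w, u <= w <= v ->
    mdist (f u) (f w) < e%:num /\ mdist (f v) (f w) < e%:num.

End Chains.

Notation strong e f := (subdivision (strongly_close e f)).

Section StrongChains.
Context {R : realType} {X : metricType R}.
Implicit Types (e : {posnum R}) (x y : X) (a b : R) (f : R -> X).

Lemma strong_echainP e a b f s :
  strong_echain e a b f s <-> strong e f a b s.
Proof.
rewrite /strong_echain /itv_partition.
have Q u v : strongly_close e f u v <->
    f @` `[u, v] `<=` ball (f u) e%:num `&` ball (f v) e%:num.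
  rewrite !ballEmdist; split=> [h _ [w + <-]|h w wuv].
    by rewrite /= in_itv; exact: h.
  by apply: (h (f w)); exists w => //=; rewrite in_itv.
split=> [[[ps /eqP ls] hs]|h].
  have {}hs : forall i, (i < size s)%N ->
      strongly_close e f (nth b (a :: s) i) (nth b s i).
    by move=> i /hs /Q.
  elim: s a ps ls hs => [|t s IH] a /=.
    by move=> _ <- _; exact: subdivision_nil.
  move=> /andP[at_ ps] ls hs; apply: subdivision_cons => //.
    exact: (hs 0%N).
  by apply: IH => // i; exact: (hs i.+1).
have ll := subdivision_last h.
split; first split; [|exact/eqP|].
  by elim: h {ll} => //= {}a t {}b {}s -> _ _ ->.
suff H d i : (i < size s)%N ->
    strongly_close e f (nth d (a :: s) i) (nth d s i).
  by move=> i si /=; apply/Q; exact: H.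
elim: h i {ll} => //= {}a t {}b {}s _ Qat _ IH [|i] //= si.
exact: IH.
Qed.

Lemma strong_exists e a b f : a <= b -> ucont a b f ->
  exists s, strong e f a b s.
Proof.
move=> ab uf; have [d d0 h] := uf _ (gt0 e).
apply: (subdivision_exists d0 ab) => // u v au uv vb vu w /andP[uw wv].
by split; apply: h; rewrite ?ltr_norml; lra.
Qed.

Lemma subdivision_chain e a b f s : strong e f a b s ->
  echain e (f a) (map f s) /\ last (f a) (map f s) = f b.
Proof.
elim=> //= {}a t {}b {}s at_ Q _ [c l]; split => //.
rewrite /echain /= -/(echain e (f t) _) c andbT /eclose.
by case: (Q t) => //; rewrite lexx ltW.
Qed.

(** A discrete counterpart of a lift to X_e: G t is a chain from x to f t,
    which is prolonged up to e-homotopy by the points of f over short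
    intervals. Taking G with values in chains rather than classes lets one
    build it by hand, and compare it with a lift to X_e by choosing
    representatives. *)
Definition chain_lift e x a b f d (G : R -> seq X) : Prop :=
  (forall t, a <= t <= b -> echain e x (G t) /\ last x (G t) = f t) /\
  forall u v, a <= u -> u <= v -> v <= b -> v - u < d ->
    ehomotopic e x (G v) (rcons (G u) (f v)).

Lemma echain_rcons e x (s : seq X) y : echain e x (rcons s y) =
  echain e x s && (mdist (last x s) y < e%:num).
Proof. by rewrite /echain rcons_path. Qed.

(** Travelling from u to v in steps of length less than d, each new point
    f w' is within e of f u, so that the intermediate point f w may be
    dropped. *)
Lemma chain_lift_close e x a b f d G u v :
  0 < d -> chain_lift e x a b f d G ->
  a <= u -> u <= v -> v <= b -> strongly_close e f u v ->
  ehomotopic e x (G v) (rcons (G u) (f v)).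
Proof.
move=> d0 [Gc Gl] au uv vb Q.
have [cu lu] := Gc u ltac:(lra).
apply: (@step_ind R u v (fun w => ehomotopic e x (G w) (rcons (G u) (f w)))
  d d0); last by lra.
  by apply: Gl; lra.
move=> w w' uw ww' wv dw IH.
have h : ehomotopic e x (G w') (rcons (G w) (f w')) by apply: Gl; lra.
have [cw lw] := Gc w ltac:(lra).
have [cw' lw'] := Gc w' ltac:(lra).
have fw : mdist (f w) (f w') < e%:num.
  by move: (cw'); rewrite (ehomotopic_echain h) echain_rcons lw => /andP[].
apply: (ehomotopic_trans h).
apply: (@ehomotopic_trans _ _ _ _ _ (rcons (rcons (G u) (f w)) (f w'))).
  by apply: ehomotopic_rcons IH; rewrite lw.
apply: ehomotopic_skip; rewrite ?lu //.
  by case: (Q w) => //; lra.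
by case: (Q w') => //; lra.
Qed.

(** The right-hand side depends on the strong chain, the left-hand side does
    not: this is where the independence of the strong chain comes from. *)
Lemma chain_lift_strong e x a b f d G u v s :
  0 < d -> chain_lift e x a b f d G ->
  a <= u -> v <= b -> strong e f u v s ->
  ehomotopic e x (G v) (G u ++ map f s).
Proof.
move=> d0 Gl + + h; elim: h => [t au tb|{}u t {}v {}s ut Q h IH au vb].
  by rewrite cats0; exact: ehomotopic_refl.
have tv := subdivision_le h.
apply: ehomotopic_trans (IH _ vb) _; first by lra.
rewrite -cat_rcons; apply: ehomotopic_catr.
  have [+ _] := subdivision_chain h.
  by case: Gl => /(_ t ltac:(lra))[_ ->].
by apply: (chain_lift_close d0 Gl) => //; lra.
Qed.

(** A lift on [a, c] is prolonged to [a, c'], for c' close to c, by adding to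
    the chain over c the single point f t. *)
Lemma chain_lift_exists e a b f : a <= b -> ucont a b f ->
  exists d G, [/\ 0 < d, chain_lift e (f a) a b f d G &
      ehomotopic e (f a) (G a) [::]].
Proof.
move=> ab uf; have [d d0 h] := uf _ (gt0 e); exists d.
have {}h u v : a <= u -> u <= v -> v <= b -> v - u < d ->
    mdist (f u) (f v) < e%:num.
  by move=> ? ? ? ?; apply: h; rewrite ?ltr_norml; lra.
suff [G [? ?]] : exists G, chain_lift e (f a) a b f d G /\
    ehomotopic e (f a) (G a) [::].
  by exists G.
apply: (@step_ind R a b (fun c => exists G, chain_lift e (f a) a c f d G /\
  ehomotopic e (f a) (G a) [::]) d d0); last by lra.
  exists (fun=> [:: f a]); split; last exact: (ehomotopic_dup (s := [::])).
  split=> [t ta|u v *].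
    have -> : t = a by lra.
    by rewrite /echain /= eclose_refl.
  have -> : v = a by lra.
  by apply: ehomotopic_sym; apply: (ehomotopic_dup (s := [:: f a]));
    rewrite /echain /= eclose_refl.
move=> c c' ac cc' cb dc [G [[Gc Gl] Ga]].
exists (fun t => if t <= c then G t else rcons (G c) (f t)); rewrite ac.
split => //; have [Gcc Gcl] := Gc c ltac:(lra); split.
  move=> t tac; case: leP => tc; first by apply: Gc; lra.
  by rewrite last_rcons echain_rcons Gcc Gcl; split => //; apply: h; lra.
move=> u v au uv vc' vu; case: (leP v c) => vc.
  by rewrite ifT; [apply: Gl|lra].
case: leP => uc.
  have [Guc Gul] := Gc u ltac:(lra).
  apply: (@ehomotopic_trans _ _ _ _ _ (rcons (rcons (G u) (f c)) (f v))).
    by apply: ehomotopic_rcons; [rewrite Gcl; apply: h; lra|apply: Gl; lra].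
  by apply: ehomotopic_skip => //; rewrite ?Gul; apply: h; lra.
by apply/ehomotopic_sym/ehomotopic_skip => //; rewrite ?Gcl; apply: h; lra.
Qed.

Lemma strong_unique e a b f s s' : ucont a b f ->
  strong e f a b s -> strong e f a b s' ->
  ehomotopic e (f a) (map f s) (map f s').
Proof.
move=> uf hs hs'; have ab := subdivision_le hs.
have [d [G [d0 Gl G0]]] := chain_lift_exists e ab uf.
have H t : strong e f a b t -> ehomotopic e (f a) (G b) (map f t).
  move=> ht; apply: ehomotopic_trans (chain_lift_strong d0 Gl _ _ ht) _ => //.
  apply: (ehomotopic_catr (s' := [::])) => //.
  by rewrite (ehomotopic_last G0); case: (subdivision_chain ht).
exact: ehomotopic_trans (ehomotopic_sym (H s hs)) (H s' hs').
Qed.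

End StrongChains.

Section Lift.
Context {R : realType} {X : metricType R} (pt : X) (e : {posnum R}).

(** A chain of length less than e is e-homotopic to its endpoints, so that
    points of X_e at distance less than e differ by a single point. *)
Lemma epsdist_lt (A B : Xeps e pt) : mdist A B < e%:num ->
  ehomotopic e pt (repr B) (rcons (repr A) (endpoint B)).
Proof.
move=> AB.
have [s hs ls] : exists2 s,
    ehomotopic e (endpoint A) (chain_inv pt (repr A) ++ repr B) s &
    chain_length (endpoint A) s < e%:num.
  have /inf_lt [|_ [s hs <-] ls] : epsdist A B < e%:num := AB; last by exists s.
  exists (chain_length (endpoint A) (chain_inv pt (repr A) ++ repr B)).
  by exists (chain_inv pt (repr A) ++ repr B) => //; exact: ehomotopic_refl.
have cA := echain_valP (repr A); have cB := echain_valP (repr B).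
have ci : echain e (endpoint A) (chain_inv pt (repr A) ++ repr B).
  rewrite /echain cat_path chain_inv_last -/(echain e pt _) cB andbT.
  by have := echain_inv e pt (repr A); rewrite cA.
have lastB : endpoint B = last (endpoint A) s.
  by rewrite -(ehomotopic_last hs) last_cat chain_inv_last.
have {}hs : ehomotopic e (endpoint A) (chain_inv pt (repr A) ++ repr B)
    [:: endpoint B].
  apply: (ehomotopic_trans hs); move: ls lastB; have := ci;
    rewrite (ehomotopic_echain hs).
  case/lastP: s {hs} => [_ _ /= ->|s y]; last first.
    by rewrite last_rcons => cs ls ->; exact: ehomotopic_short.
  exact/ehomotopic_sym/(ehomotopic_dup (s := [::])).
apply: (@ehomotopic_trans _ _ _ _ _
  (repr A ++ chain_inv pt (repr A) ++ repr B)).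
  apply: ehomotopic_sym; rewrite catA; apply: (ehomotopic_catr (s' := [::])).
    by rewrite last_cat chain_inv_last.
  exact: ehomotopic_mulV.
by rewrite -cats1; exact: ehomotopic_catl.
Qed.

Lemma lift_strong a b (f : R -> X) (F : R -> Xeps e pt) s : is_lift a b f F ->
  strong e f a b s ->
  ehomotopic e pt (repr (F b)) (repr (F a) ++ map f s).
Proof.
move=> [pF FE] hs; have [d d0 h] := path_ucont pF (gt0 e).
have FE' t : a <= t <= b -> endpoint (F t) = f t.
  by move=> ?; apply: FE; rewrite in_itv.
apply: (@chain_lift_strong _ _ e pt a b f d (fun t => repr (F t))) => //; split.
  by move=> t /FE' <-; split => //; exact: echain_valP.
move=> u v au uv vb vu; rewrite -FE'; last by lra.
by apply: epsdist_lt; apply: h; rewrite ?ltr_norml; lra.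
Qed.

Lemma lift_closed a b (f : R -> X) (F : R -> Xeps e pt) s : is_lift a b f F ->
  strong e f a b s ->
  ehomotopic e (f a) (map f s) [::] -> F a = F b.
Proof.
move=> Fl hs hn; have := lift_strong Fl hs => h.
rewrite -[F a]reprK -[F b]reprK; apply/Xeps_eqP.
apply: ehomotopic_sym; apply: (ehomotopic_trans h).
have cA := echain_valP (repr (F a)).
rewrite -[X in ehomotopic _ _ _ X]cats0; apply: ehomotopic_catl => //.
have [[ab _] FE] := Fl; have := FE a;
  rewrite in_itv /= lexx ltW // => /(_ erefl).
by rewrite /endpoint => ->.
Qed.

End Lift.

(** * Homotopy invariance of strong chains *)

Section Homotopy.
Context {R : realType} {X : metricType R}.
Implicit Types (e : {posnum R}) (a b : R) (f p q : R -> X).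

(** The condition on a square with lower side p u, p v and upper side q u,
    q v, cut by the diagonal from p u to q v, which lets a chain pass across
    that square. *)
Definition ladder e p q u v : Prop :=
  [/\ mdist (p u) (p v) < e%:num, mdist (p u) (q v) < e%:num,
      mdist (q u) (q v) < e%:num & mdist (p v) (q v) < e%:num].

Lemma subdivision_echain e p a b s :
  subdivision (fun u v => mdist (p u) (p v) < e%:num) a b s ->
  echain e (p a) (map p s).
Proof. by elim=> //= {}a t {}b {}s _ Q _ c; rewrite /echain /= /eclose Q. Qed.

(** The last rung of the ladder is pushed back to the first one square after
    square, through the diagonals. *)
Lemma ehomotopic_ladder e p q a b s : mdist (p a) (q a) < e%:num ->
  subdivision (ladder e p q) a b s ->
  ehomotopic e (p a) (rcons (map p s) (q b)) (q a :: map q s).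
Proof.
move=> + h; elim: h =>
  [{}a _|{}a t {}b {}s _ [pp pq qq pqt] h /(_ pqt) IH pqa] /=.
  exact: ehomotopic_refl.
have cq : echain e (q t) (map q s).
  by apply: subdivision_echain; apply: subdivision_impl h => u v _ _ _ [].
have drop x y : mdist x y < e%:num -> mdist y (q t) < e%:num ->
    mdist x (q t) < e%:num ->
    ehomotopic e x (y :: q t :: map q s) (q t :: map q s).
  move=> xy yq xq; apply: (@ehomotopic_drop _ _ e x [::]) => //=;
  by rewrite /echain /= /eclose ?xy ?yq ?xq.
apply: (@ehomotopic_trans _ _ _ _ _ (p t :: q t :: map q s)).
  by apply: (@ehomotopic_catl _ _ e (p a) [:: p t]) => //=;
    rewrite /echain /= /eclose pp.
apply: ehomotopic_trans (drop _ _ pp pqt pq) _.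
exact: ehomotopic_sym (drop _ _ pqa qq pq).
Qed.

Lemma map_subdivision Q a b s f g : subdivision Q a b s ->
  (forall u, a <= u <= b -> f u = g u) -> map f s = map g s.
Proof.
elim=> //= {}a t {}b {}s at_ _ h IH fg; have tb := subdivision_le h.
by rewrite fg ?IH // => [u ?|]; [apply: fg|]; lra.
Qed.

(** A partition r finer than a modulus of continuity of the homotopy is strong
    along both loops, and two rows of the homotopy at close times form a
    ladder over r, whose first and last rungs are trivial. *)
Lemma homotopic_strong e (pt : X) (f g : loop_at pt) s s' :
  path_homotopic pt f g -> strong e f 0 1 s ->
  strong e g 0 1 s' -> ehomotopic e pt (map f s) (map g s').
Proof.
move=> [H [cH H0 H1 Hb]] hs hs'.
have csq := compact_setX (@segment_compact R 0 1) (@segment_compact R 0 1).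
have [d d0 hd] := compact_ucont csq cH (gt0 e).
have {}hd u v t t' : 0 <= u <= 1 -> 0 <= v <= 1 -> 0 <= t <= 1 ->
    0 <= t' <= 1 ->
   `|u - v| < d -> `|t - t'| < d -> mdist (H (u, t)) (H (v, t')) < e%:num.
  by move=> *; apply: hd; split => //=; rewrite in_itv.
have [r hr] := @subdivision_exists R (fun u v => v - u < d) 0 1 d d0 ler01
  (fun _ _ _ _ _ h => h).
have sub (Q : R -> R -> Prop) : (forall u v, 0 <= u <= 1 -> 0 <= v <= 1 ->
    u < v -> v - u < d -> Q u v) -> subdivision Q 0 1 r.
  move=> QQ; apply: subdivision_impl hr => u v ? ? ? ?; apply: QQ => //; lra.
have row t : 0 <= t <= 1 ->
    ehomotopic e pt [seq H (u, 0) | u <- r] [seq H (u, t) | u <- r].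
  apply: (@step_ind R 0 1 (fun t =>
    ehomotopic e pt [seq H (u, 0) | u <- r] [seq H (u, t) | u <- r]) d d0).
    exact: ehomotopic_refl.
  move=> {}t t' t0 tt' t'1 dt IH; apply: (ehomotopic_trans IH).
  have hb w : 0 <= w <= 1 -> H (0, w) = pt /\ H (1, w) = pt.
    by move=> ?; apply: Hb; rewrite in_itv.
  have [p0 p1] := hb t ltac:(lra).
  have [q0 q1] := hb t' ltac:(lra).
  have ch w : 0 <= w <= 1 -> echain e pt [seq H (u, w) | u <- r].
    move=> w01; have [<- _] := hb w w01.
    apply: (@subdivision_echain e (fun u => H (u, w)) 0 1); apply: sub => u v *.
    by apply: hd; rewrite ?ltr_norml //; lra.
  have rl w : 0 <= w <= 1 -> last pt [seq H (u, w) | u <- r] = pt.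
    move=> w01; have [a0 a1] := hb w w01; rewrite -{1}a0.
    by rewrite (last_map (fun u => H (u, w))) (subdivision_last hr).
  have lad : subdivision (ladder e (fun u => H (u, t)) (fun u => H (u, t')))
      0 1 r.
    by apply: sub => u v *; split; apply: hd; rewrite ?ltr_norml //; lra.
  have := ehomotopic_ladder _ lad; rewrite p0 q0 q1 mdistxx => /(_ (gt0 e)) h.
  apply: (@ehomotopic_trans _ _ _ _ _ (rcons [seq H (u, t) | u <- r] pt)).
    have := ehomotopic_dup (ch t ltac:(lra)); rewrite rl; last by lra.
    exact: ehomotopic_sym.
  apply: (ehomotopic_trans h); have c' := ch t' ltac:(lra).
  by apply: (@ehomotopic_drop _ _ e pt [::]) => //=;
    rewrite /echain /= eclose_refl.
have str k t : 0 <= t <= 1 -> (forall u, 0 <= u <= 1 -> k u = H (u, t)) ->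
    strong e k 0 1 r.
  move=> t01 kE; apply: sub => u v ? ? ? ? w ?.
  by rewrite !kE; [split; apply: hd; rewrite ?ltr_norml //; lra|lra|lra|lra].
have fE u : 0 <= u <= 1 -> f u = H (u, 0) by move=> ?; rewrite H0 ?in_itv.
have gE u : 0 <= u <= 1 -> g u = H (u, 1) by move=> ?; rewrite H1 ?in_itv.
have rf := str f 0 ltac:(lra) fE; have rg := str g 1 ltac:(lra) gE.
have := row 1 ltac:(lra).
rewrite -(map_subdivision hr fE) -(map_subdivision hr gE).
have := strong_unique (path_ucont (loop_path f)) hs rf; rewrite loop0 => h1 h2.
have := strong_unique (path_ucont (loop_path g)) rg hs'; rewrite loop0 => h3.
exact: ehomotopic_trans h1 (ehomotopic_trans h2 h3).
Qed.

End Homotopy.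

(** * Concatenation of paths *)

Section Reparam.
Context {R : realType} {X : metricType R}.
Implicit Types (e : {posnum R}) (a b : R) (f g : R -> X).

(** The loss of a factor 2 comes from pairs of points on either side of
    c. *)
Lemma uclose_glue (e : R) a c b f :
  uclose (e / 2) a c f -> uclose (e / 2) c b f -> uclose e a b f.
Proof.
move=> [d d0 hd] [d' d'0 hd']; exists (Num.min d d');
  first by rewrite lt_min d0.
have H u v : a <= u -> u <= v -> v <= b -> v - u < Num.min d d' ->
    mdist (f u) (f v) < e.
  rewrite lt_min => au uv vb /andP[ud ud'].
  have [vc|cv] := leP v c.
    have := hd u v ltac:(lra) ltac:(lra);
      rewrite ltr_norml => /(_ ltac:(lra)) h.
    have := mdist_ge0 (f u) (f v); lra.
  have [cu|uc] := leP c u.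
    have := hd' u v ltac:(lra) ltac:(lra);
      rewrite ltr_norml => /(_ ltac:(lra)) h.
    have := mdist_ge0 (f u) (f v); lra.
  have := hd u c ltac:(lra) ltac:(lra); rewrite ltr_norml => /(_ ltac:(lra)) h.
  have := hd' c v ltac:(lra) ltac:(lra);
    rewrite ltr_norml => /(_ ltac:(lra)) h'.
  have := metric_triangle (f u) (f c) (f v); lra.
move=> u v uab vab; rewrite ltr_norml => /andP[? ?].
have [uv|vu] := leP u v; first by apply: H; lra.
by rewrite metric_sym; apply: H; lra.
Qed.

Lemma ucont_glue a c b f : ucont a c f -> ucont c b f -> ucont a b f.
Proof.
by move=> h h' e e0; apply: (@uclose_glue _ _ c); [apply: h|apply: h']; lra.
Qed.

Lemma ucont_affine k m a b f g : 0 < k -> ucont a b f ->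
  (forall u, a <= u <= b -> g (k * u + m) = f u) ->
  ucont (k * a + m) (k * b + m) g.
Proof.
move=> k0 uf gE e e0; have [d d0 h] := uf _ e0; exists (k * d).
  exact: mulr_gt0.
move=> u v uab vab uv.
pose u' := (u - m) / k; pose v' := (v - m) / k.
have uE : u = k * u' + m by rewrite /u' mulrC divfK ?gt_eqF// subrK.
have vE : v = k * v' + m by rewrite /v' mulrC divfK ?gt_eqF// subrK.
have hu' : a <= u' <= b by move: uab; rewrite uE !lerD2r !ler_pM2l.
have hv' : a <= v' <= b by move: vab; rewrite vE !lerD2r !ler_pM2l.
rewrite uE vE !gE //; apply: h => //.
have : `|k * (u' - v')| < k * d by congr (`|_| < _): uv; rewrite uE vE; lra.
by rewrite normrM gtr0_norm // ltr_pM2l.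
Qed.

Lemma strong_affine e k m a b f g s : 0 < k ->
  (forall u, a <= u <= b -> g (k * u + m) = f u) ->
  strong e f a b s ->
  exists2 s', strong e g (k * a + m) (k * b + m) s' &
    map g s' = map f s.
Proof.
move=> k0 + h; elim: h => [{}a _|{}a t {}b {}s at_ Q h IH gE].
  by exists [::] => //; exact: subdivision_nil.
have tb := subdivision_le h.
have [u ut|s' hs' es'] := IH; first by apply: gE; lra.
exists (k * t + m :: s'); last by rewrite /= es' gE //; lra.
apply: subdivision_cons hs'; first by rewrite ltrD2r ltr_pM2l.
move=> w wat; pose w' := (w - m) / k.
have wE : w = k * w' + m by rewrite /w' mulrC divfK ?gt_eqF// subrK.
have hw' : a <= w' <= t by move: wat; rewrite wE !lerD2r !ler_pM2l.
by rewrite wE !gE //; [exact: Q|lra|lra|lra].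
Qed.

Lemma path_cat_left f g u : u <= 1 -> path_cat f g (1 / 2 * u + 0) = f u.
Proof. by move=> u1; rewrite /path_cat ifT; [congr f|]; lra. Qed.

Lemma path_cat_right f g u : f 1 = g 0 -> 0 <= u ->
  path_cat f g (1 / 2 * u + 1 / 2) = g u.
Proof.
move=> fg; rewrite le_eqVlt => /predU1P[<-|u0].
  by rewrite -fg /path_cat ifT; [congr f|]; lra.
by rewrite /path_cat ifF; [congr g; lra|apply/negbTE; rewrite -ltNge; lra].
Qed.

Lemma path_cat_ucont f g : f 1 = g 0 -> ucont 0 1 f -> ucont 0 1 g ->
  ucont 0 1 (path_cat f g).
Proof.
move=> fg uf ug; apply: (@ucont_glue _ (1 / 2)).
  have := @ucont_affine (1 / 2) 0 0 1 f (path_cat f g) ltac:(lra) uf.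
  rewrite mulr0 mulr1 !addr0; apply => u ?.
  by have := @path_cat_left f g u; rewrite addr0; apply; lra.
have := @ucont_affine (1 / 2) (1 / 2) 0 1 g (path_cat f g) ltac:(lra) ug.
rewrite mulr0 add0r mulr1 -splitr; apply => u ?.
by apply: path_cat_right => //; lra.
Qed.

Lemma path_cat_strong e f g s t : f 1 = g 0 ->
  strong e f 0 1 s -> strong e g 0 1 t ->
  exists2 r, strong e (path_cat f g) 0 1 r &
    map (path_cat f g) r = map f s ++ map g t.
Proof.
move=> fg hs ht.
have [u|s' hs' es] := @strong_affine e (1 / 2) 0 0 1 f (path_cat f g) s
    ltac:(lra) _ hs.
  by move=> ?; apply: path_cat_left; lra.
have [u|t' ht' et] := @strong_affine e (1 / 2) (1 / 2) 0 1 g (path_cat f g) t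
    ltac:(lra) _ ht.
  by move=> ?; apply: path_cat_right => //; lra.
exists (s' ++ t'); last by rewrite map_cat es et.
move: hs' ht'; rewrite mulr0 mulr1 !addr0 add0r -splitr; exact: subdivision_cat.
Qed.

End Reparam.

(** * The homomorphism h_e and the cosets of pi_cl(X) *)

Section Heps.
Context {R : realType} {X : metricType R} (pt : X) (e : {posnum R}).
Implicit Types (f g : loop_at pt).
Local Open Scope quotient_scope.

Lemma strong_loop f s : strong e f 0 1 s ->
  exists l : echain_loop e pt, l = map f s :> seq X.
Proof.
move=> /subdivision_chain[]; rewrite loop0 loop1 => c l.
have h : echain e pt (map f s) && (last pt (map f s) == pt) by rewrite c l eqxx.
by exists (EChainLoop h).
Qed.

(** By homotopy invariance, all the pairs of a representative and a strong chain
    among which h_e chooses give the same class. *)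
Lemma heps_strong f s (l : echain_loop e pt) :
  strong e f 0 1 s -> l = map f s :> seq X ->
  heps e (\pi_(pi1 pt) f) = \pi_(pieps e pt) l.
Proof.
move=> hs lE; rewrite /heps; case: xgetP => [c -> | /(_ (\pi_(pieps e pt) l))].
  move=> [f' [s' [l' [ff' /strong_echainP hs' l'E ->]]]].
  apply/pieps_eqP; rewrite lE l'E; apply: homotopic_strong hs' hs.
  exact/path_homotopic_sym/pi1_eqP.
by case; exists f, s, l; split => //; exact/strong_echainP.
Qed.

Lemma hepsM (a b : pi1 pt) : heps e (a * b)%g = (heps e a * heps e b)%g.
Proof.
rewrite -[a]reprK -[b]reprK; move: (repr a) (repr b) => f g {a b}.
have [s hs] := strong_exists e ler01 (path_ucont (loop_path f)).
have [t ht] := strong_exists e ler01 (path_ucont (loop_path g)).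
have [l lE] := strong_loop hs; have [l' l'E] := strong_loop ht.
have [|r hr rE] := path_cat_strong _ hs ht; first by rewrite loop0 loop1.
rewrite (heps_strong hs lE) (heps_strong ht l'E).
have -> : (\pi_(pi1 pt) f * \pi_(pi1 pt) g)%g = \pi_(pi1 pt) (loop_cat f g).
  exact: pi1_mulE.
have -> : (\pi_(pieps e pt) l * \pi_(pieps e pt) l')%g =
    \pi_(pieps e pt) (eloop_cat l l').
  exact: pieps_mulE.
by apply: (@heps_strong (loop_cat f g) r) => //; rewrite /= rE lE l'E.
Qed.

Lemma heps1 : heps e (1%g : pi1 pt) = 1%g.
Proof. by apply: (mulgI (heps e 1%g)); rewrite -hepsM !mulg1. Qed.

End Heps.

(** As f lies in its own coset, f = g k with k in the kernel of every h_e, whence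
    h_e(f) = h_e(g) for every e. *)
Lemma coset_homotopic (R : realType) (X : metricType R) (pt : X)
    (f g : loop_at pt) :
  [set (\pi_(pi1 pt)%qT f * k)%g | k in pi_cl pt] =
  [set (\pi_(pi1 pt)%qT g * k)%g | k in pi_cl pt] ->
  forall (e : {posnum R}) s t, strong e f 0 1 s ->
    strong e g 0 1 t -> ehomotopic e pt (map f s) (map g t).
Proof.
move=> fg e s t hs ht.
have : [set (\pi_(pi1 pt)%qT f * k)%g | k in pi_cl pt] (\pi_(pi1 pt)%qT f).
  by exists 1%g; [move=> e' _; exact: heps1|exact: mulg1].
rewrite fg => -[k /(_ e I) hk gk].
have [l lE] := strong_loop hs; have [l' l'E] := strong_loop ht.
rewrite -lE -l'E; apply/pieps_eqP.
rewrite -(heps_strong hs lE) -(heps_strong ht l'E) -gk hepsM.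
by move: hk; rewrite /Keps /= => ->; rewrite mulg1.
Qed.

(** * Small loops that do not lift closed *)

Section Cancel.
Context {R : realType} {X : metricType R}.
Implicit Types (e : {posnum R}) (x : X).

Lemma ehomotopic_cancell e x (s t t' : seq X) : echain e x s ->
  echain e (last x s) t -> ehomotopic e x (s ++ t) (s ++ t') ->
  ehomotopic e (last x s) t t'.
Proof.
move=> cs ct h.
have ct' : echain e (last x s) t'.
  have := ehomotopic_echain h; rewrite /echain !cat_path -!/(echain _ _ _).
  by rewrite cs ct /= => <-.
have ci : echain e (last x s) (chain_inv x s) by rewrite echain_inv.
have H u : echain e (last x s) u ->
    ehomotopic e (last x s) (chain_inv x s ++ s ++ u) u.
  move=> cu; rewrite catA; apply: (ehomotopic_catr (s' := [::])).
    by rewrite last_cat chain_inv_last.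
  exact: ehomotopic_Vmul.
apply: ehomotopic_trans (ehomotopic_sym (H _ ct)) _.
apply: ehomotopic_trans _ (H _ ct').
by apply: ehomotopic_catl => //; rewrite chain_inv_last.
Qed.

Lemma ehomotopic_cancelr e x (s s' t : seq X) : last x s = last x s' ->
  echain e x s -> echain e x s' -> echain e (last x s) t ->
  ehomotopic e x (s ++ t) (s' ++ t) -> ehomotopic e x s s'.
Proof.
move=> l cs cs' ct h.
have H u : last x u = last x s -> echain e x u ->
    ehomotopic e x ((u ++ t) ++ chain_inv (last x s) t) u.
  move=> lu cu; rewrite -catA -[X in ehomotopic _ _ _ X]cats0.
  by apply: ehomotopic_catl => //; rewrite lu; exact: ehomotopic_mulV.
apply: ehomotopic_trans (ehomotopic_sym (H _ erefl cs)) _.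
apply: ehomotopic_trans _ (H _ (esym l) cs').
by apply: ehomotopic_catr h; rewrite last_cat echain_inv.
Qed.

End Cancel.

Section BadLoop.
Context {R : realType} {X : metricType R}.
Implicit Types (e : {posnum R}) (a b : R) (f : R -> X).

Lemma unit_reparam e a b f : a < b -> ucont a b f ->
  let g := fun t => f ((b - a) * t + a) in
  ucont 0 1 g /\ forall s, strong e f a b s ->
    exists2 s', strong e g 0 1 s' & map g s' = map f s.
Proof.
move=> ab uf g.
have ba : b - a != 0 by rewrite subr_eq0 gt_eqF.
have k0 : 0 < (b - a)^-1 by rewrite invr_gt0 subr_gt0.
have gE u : a <= u <= b -> g ((b - a)^-1 * u + - ((b - a)^-1 * a)) = f u.
  by move=> _; rewrite /g -mulrBr mulVKf // subrK.
split=> [|s hs].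
  by have := ucont_affine k0 uf gE; rewrite -!mulrBr subrr mulr0 mulVf.
have [s' + es] := strong_affine k0 gE hs.
by rewrite -!mulrBr subrr mulr0 mulVf //; exists s'.
Qed.

(** The length of the geodesic bounds the length of the chain through its
    endpoints and any third point, so the geodesic from x to y stays in the
    closed balls around x and y of radius d(x, y). *)
Lemma geodesic_path (geoX : geodesic_space X) (x y : X) : exists f : R -> X,
  [/\ ucont 0 1 f, f 0 = x, f 1 = y & forall t, 0 <= t <= 1 ->
    mdist x (f t) <= mdist x y /\ mdist y (f t) <= mdist x y].
Proof.
have [a [b [f [pf fa fb lf]]]] := geoX x y.
have ab : a < b by case: pf.
have [uf _] := unit_reparam 1%:pos ab (path_ucont pf).
exists (fun t => f ((b - a) * t + a)); split => //.
- by rewrite mulr0 add0r.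
- by rewrite mulr1 subrK.
move=> t t01; set u := _ + a.
have uab : a <= u <= b by rewrite /u; nra.
have d0 := mdist_ge0 x (f u); have d1 := mdist_ge0 (f u) y.
rewrite (metric_sym y).
suff : mdist x (f u) + mdist (f u) y <= mdist x y by lra.
have [ua|ua] := eqVneq u a; first by rewrite ua fa mdistxx add0r.
have [ub|ub] := eqVneq u b; first by rewrite ub fb mdistxx addr0.
have : ((mdist x (f u) + mdist (f u) y)%:E <= curve_length a b f)%E.
  apply: ereal_sup_ubound; exists [:: u; b].
    split=> //=; rewrite !lt_neqAle ub eq_sym ua /=; lra.
  by rewrite /= fa fb !chain_length_cons /chain_length /= big_nil addr0.
by rewrite lf lee_fin.
Qed.

Definition bad_loop (x : X) (r : R) (l : R -> X) (e : {posnum R}) : Prop :=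
  [/\ ucont 0 1 l, l 0 = x, l 1 = x,
      forall t, 0 <= t <= 1 -> mdist x (l t) < r &
      forall s, strong e l 0 1 s ->
        ~ ehomotopic e x (map l s) [::]].

Lemma path_cat_range (f g : R -> X) (P : X -> Prop) :
  (forall t, 0 <= t <= 1 -> P (f t)) -> (forall t, 0 <= t <= 1 -> P (g t)) ->
  forall t, 0 <= t <= 1 -> P (path_cat f g t).
Proof.
by move=> hf hg t t01; rewrite /path_cat; case: leP => ?;
  [apply: hf|apply: hg]; lra.
Qed.

Lemma path_catE0 (f g : R -> X) : path_cat f g 0 = f 0.
Proof. by rewrite -(@path_cat_left _ _ f g 0) ?mulr0 ?addr0. Qed.

Lemma path_catE1 (f g : R -> X) : path_cat f g 1 = g 1.
Proof.
by rewrite /path_cat ifF; [congr g; lra|apply/negbTE; rewrite -ltNge; lra].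
Qed.

(** Let p and q be geodesics from x to f a and back. If the strong chains of
    both p q and p f q were e-null, then so would be those of f, by
    cancellation. So one of these two loops is bad; considering both
    avoids taking for q the reverse of p. *)
Lemma bad_loop_exists (geoX : geodesic_space X) (pt x : X) (r : R) a b f e :
  path_loop a b f -> f @` `[a, b] `<=` ball x r -> ~ lifts_closed pt e a b f ->
  exists l, bad_loop x r l e.
Proof.
move=> [pf fab] fr nl; have ab : a < b by case: pf.
have {}fr t : a <= t <= b -> mdist x (f t) < r.
  by move=> tab; have := fr (f t); rewrite ballEmdist; apply; exists t;
    rewrite //= in_itv.
have uf := path_ucont pf.
have [s hs] := strong_exists e (ltW ab) uf.
have ns : ~ ehomotopic e (f a) (map f s) [::].
  by move=> sn; apply: nl => F hF; exact: lift_closed hF hs sn.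
pose g t := f ((b - a) * t + a).
have [ug /(_ s hs) [sg hg eg]] : _ := unit_reparam e ab uf;
  rewrite -/g in ug hg eg.
have g0 : g 0 = f a by rewrite /g mulr0 add0r.
have g1 : g 1 = f a by rewrite /g mulr1 subrK.
have gr t : 0 <= t <= 1 -> mdist x (g t) < r by move=> ?; apply: fr; nra.
have far : mdist x (f a) < r by apply: fr; lra.
have [p [up p0 p1 pr]] := geodesic_path geoX x (f a).
have [q [uq q0 q1 qr]] := geodesic_path geoX (f a) x.
have [sp hp] := strong_exists e ler01 up.
have [sq hq] := strong_exists e ler01 uq.
have {}pr t : 0 <= t <= 1 -> mdist x (p t) < r by move=> /pr[? _]; lra.
have {}qr t : 0 <= t <= 1 -> mdist x (q t) < r.
  by move=> /qr[_ ?]; rewrite metric_sym in far; lra.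
have [cp lp] := subdivision_chain hp; have [cq lq] := subdivision_chain hq.
have [cg lg] := subdivision_chain hg.
rewrite p0 p1 q0 q1 g0 g1 in cp lp cq lq cg lg.
apply: contrapT => nbad.
have null l sl : ucont 0 1 l -> l 0 = x -> l 1 = x ->
    (forall t, 0 <= t <= 1 -> mdist x (l t) < r) ->
    strong e l 0 1 sl -> ehomotopic e x (map l sl) [::].
  move=> ul l0 l1 lr hl; apply: contrapT => nh; apply: nbad; exists l;
    split => //.
  move=> sl' hl' h; apply: nh; apply: ehomotopic_trans h.
  by rewrite -l0; exact: strong_unique ul hl hl'.
have gq : g 1 = q 0 by rewrite g1.
have pq : p 1 = q 0 by rewrite p1.
have pgq : p 1 = path_cat g q 0 by rewrite path_catE0 p1.
have [s1 h1 e1] := path_cat_strong pq hp hq.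
have [s2 h2 e2] := path_cat_strong gq hg hq.
have [s3 h3 e3] := path_cat_strong pgq hp h2.
pose inball y := mdist x y < r.
have := null _ _ (path_cat_ucont pq up uq) _ _ _ h1.
rewrite path_catE0 path_catE1 e1 =>
    /(_ p0 q1 (@path_cat_range _ _ inball pr qr)) n1.
have := null _ _ (path_cat_ucont pgq up (path_cat_ucont gq ug uq)) _ _ _ h3.
have gqr := @path_cat_range _ _ inball gr qr.
rewrite path_catE0 !path_catE1 e3 e2 =>
    /(_ p0 q1 (@path_cat_range _ _ inball pr gqr)) n3.
apply: ns; rewrite -eg.
have := ehomotopic_trans n3 (ehomotopic_sym n1).
move=> /ehomotopic_cancell; rewrite lp => /(_ cp).
have cgq : echain e (f a) (map g sg ++ map q sq).
  by rewrite /echain cat_path -!/(echain _ _ _) lg cg.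
move=> /(_ cgq) => h.
by apply: (@ehomotopic_cancelr _ _ e (f a) _ [::] (map q sq)); rewrite ?lg.
Qed.

End BadLoop.

(** * Infinite concatenation *)

Section InfiniteConcatenation.
Context {R : realType} {X : metricType R}.
Implicit Types (e : {posnum R}) (n m : nat).

(* The n-th loop runs on [c n, c n + h n] = [1 - 2^-n, 1 - 2^-(n+1)]. *)
Let h n : R := (1 / 2) ^+ n.+1.
Let c n : R := 1 - (1 / 2) ^+ n.

Let h_gt0 n : 0 < h n.
Proof. by apply: exprn_gt0; lra. Qed.

Let c0 : c 0 = 0.
Proof. by rewrite /c expr0 subrr. Qed.

Let cS n : c n.+1 = h n + c n.
Proof. by rewrite /c /h exprS; lra. Qed.

Let c_lt1 n : c n < 1.
Proof.
have : 0 < (1 / 2 : R) ^+ n by apply: exprn_gt0; lra.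
by rewrite /c; lra.
Qed.

Let c_mono n m : (n <= m)%N -> c n <= c m.
Proof.
elim: m => [|m IH]; first by rewrite leqn0 => /eqP ->.
rewrite leq_eqVlt => /predU1P[-> //|/IH /le_trans]; apply.
by rewrite cS; have := h_gt0 m; lra.
Qed.

(** The default value x of the choice operator is the value at 1, the point
    at which the loops accumulate. *)
Definition infcat (x : X) (lam : nat -> R -> X) (t : R) : X :=
  xget x [set y | exists n u, [/\ 0 <= u < 1, t = h n * u + c n & y = lam n u]].

Record null_sequence (x : X) (rad : nat -> R) (lam : nat -> R -> X) : Prop :=
  NullSequence {
    ns_ucont : forall n, ucont 0 1 (lam n) ;
    ns0 : forall n, lam n 0 = x ;
    ns1 : forall n, lam n 1 = x ;
    ns_rad : forall n t, 0 <= t <= 1 -> mdist x (lam n t) < rad n }.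

Context {x : X} {rad : nat -> R}.
Context (rad_mono : forall n m, (n <= m)%N -> rad m <= rad n)
  (rad_cvg : forall e : R, 0 < e -> exists n, rad n < e)
  (rad_gt0 : forall n, 0 < rad n).

Section OneSequence.
Context {lam : nat -> R -> X} (ns : null_sequence x rad lam).

Lemma infcatE n u : 0 <= u <= 1 -> infcat x lam (h n * u + c n) = lam n u.
Proof.
have H k v : 0 <= v < 1 -> infcat x lam (h k * v + c k) = lam k v.
  move=> v01; rewrite /infcat.
  case: xgetP => [y _|/(_ (lam k v))[]]; last by exists k, v.
  have lt m w : 0 <= w < 1 -> c m <= h m * w + c m < c m.+1.
    by move=> ?; rewrite cS; have := h_gt0 m; nra.
  move=> [m [w [w01 vw ->]]]; have := lt k _ v01; have := lt m _ w01;
    rewrite -vw.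
  have [km|mk|km] := ltngtP k m.
  - by move=> *; exfalso; have := c_mono km; lra.
  - by move=> *; exfalso; have := c_mono mk; lra.
  move=> _ _; rewrite km in vw *; congr (lam m _).
  by apply: (mulfI (lt0r_neq0 (h_gt0 m))); lra.
move=> /andP[u0]; rewrite le_eqVlt => /predU1P[->|u1]; last by apply: H; lra.
have := H n.+1 0; rewrite mulr0 add0r cS mulr1 (ns0 ns) (ns1 ns) => -> //.
by rewrite lexx ltr01.
Qed.

Lemma infcat_c n : infcat x lam (c n) = x.
Proof.
have := @infcatE n 0; rewrite mulr0 add0r (ns0 ns) => -> //.
by rewrite lexx ler01.
Qed.

(** A bound on the tail that holds for every time after c n, including 1: this
    gives the continuity at 1 as well as the triviality of the tail at large
    scales. *)
Lemma infcat_tail n t : c n <= t -> mdist x (infcat x lam t) < rad n.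
Proof.
move=> nt; rewrite /infcat.
case: xgetP => [y _ [m [u [u01 tE ->]]]|_]; last by rewrite mdistxx.
apply: (@lt_le_trans _ _ (rad m)); first by apply: (ns_rad ns); lra.
apply: rad_mono; rewrite leqNgt; apply/negP => /c_mono; rewrite cS.
by have := h_gt0 m; nra.
Qed.

Lemma infcat1 : infcat x lam 1 = x.
Proof.
apply/esym/mdist_positivity/eqP; rewrite eq_le mdist_ge0 andbT leNgt.
apply/negP => /rad_cvg[n]; have := @infcat_tail n 1 (ltW (c_lt1 n)).
lra.
Qed.

Lemma infcat_ucont_head n : ucont 0 (c n) (infcat x lam).
Proof.
elim: n => [|n IH]; rewrite ?c0.
  move=> e e0; exists 1 => // u v u0 v0 _; have -> : u = v by lra.
  by rewrite mdistxx.
apply: (ucont_glue IH).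
have := ucont_affine (h_gt0 n) (ns_ucont ns n) (@infcatE n).
by rewrite mulr0 add0r mulr1 cS.
Qed.

Lemma infcat_ucont : ucont 0 1 (infcat x lam).
Proof.
(* Gluing leaves e / 2 for the tail, where two points are each within e / 4
   of x. *)
move=> e e0; have [n rn] := @rad_cvg (e / 4) ltac:(lra).
apply: (@uclose_glue _ _ _ _ (c n)).
  by apply: infcat_ucont_head; lra.
exists 1 => // u v /andP[nu _] /andP[nv _] _.
have := infcat_tail nu; have := infcat_tail nv.
have := metric_triangle (infcat x lam u) x (infcat x lam v).
rewrite (metric_sym _ x); lra.
Qed.

(** All points after c n.+1 are within rad n.+1 of x, hence within e of each
    other, so that the single interval [c n.+1, 1] is strong: the loops after
    the n-th one are invisible at scale e. *)
Lemma infcat_strong e n s t : rad n.+1 <= e%:num / 2 ->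
  strong e (infcat x lam) 0 (c n) s ->
  strong e (lam n) 0 1 t ->
  exists2 r, strong e (infcat x lam) 0 1 r &
    map (infcat x lam) r = map (infcat x lam) s ++ map (lam n) t ++ [:: x].
Proof.
move=> rn hs ht.
have [t' ht' et] := strong_affine (h_gt0 n) (@infcatE n) ht.
rewrite mulr0 add0r mulr1 -cS in ht'.
exists (s ++ t' ++ [:: 1]); last by rewrite !map_cat et /= infcat1.
apply: subdivision_cat hs _; apply: subdivision_cat ht' _.
apply: subdivision_cons; [exact: c_lt1| |exact: subdivision_nil].
have H u v : c n.+1 <= u -> c n.+1 <= v ->
    mdist (infcat x lam u) (infcat x lam v) < e%:num.
  move=> /infcat_tail hu /infcat_tail hv.
  have := metric_triangle (infcat x lam u) x (infcat x lam v).
  rewrite (metric_sym _ x); lra.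
by move=> w w01; have := c_lt1 n.+1; split; apply: H; lra.
Qed.

End OneSequence.

Lemma infcat_agree lam lam' n :
  null_sequence x rad lam -> null_sequence x rad lam' ->
  (forall m, (m < n)%N -> lam m = lam' m) ->
  forall t, 0 <= t <= c n -> infcat x lam t = infcat x lam' t.
Proof.
move=> ns ns'; elim: n => [|n IH] ag t.
  rewrite c0 => t0; have -> : t = c 0 by rewrite c0; lra.
  by rewrite !infcat_c.
move=> tn; have [tc|ct] := leP t (c n).
  by apply: IH; [move=> m mn; apply: ag; exact: ltnW|lra].
pose u := (t - c n) / h n; have hn := h_gt0 n; rewrite cS in tn.
have tE : t = h n * u + c n by rewrite /u mulrC divfK ?gt_eqF // subrK.
have u01 : 0 <= u <= 1 by move: tn ct; rewrite tE; nra.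
by rewrite tE !infcatE // ag.
Qed.

Context {pt : X} {p q : R -> X}.
Context (up : ucont 0 1 p) (uq : ucont 0 1 q) (p0 : p 0 = pt) (p1 : p 1 = x)
  (q0 : q 0 = x) (q1 : q 1 = pt).

Lemma infcat_loop lam : null_sequence x rad lam -> exists L : loop_at pt,
  L = path_cat p (path_cat (infcat x lam) q) :> (R -> X).
Proof.
move=> ns.
have fq : infcat x lam 1 = q 0 by rewrite q0 infcat1.
have pf : p 1 = path_cat (infcat x lam) q 0.
  by rewrite path_catE0 -c0 infcat_c.
have uL := path_cat_ucont pf up (path_cat_ucont fq (infcat_ucont ns) uq).
have L0 : path_cat p (path_cat (infcat x lam) q) 0 = pt by rewrite path_catE0.
have L1 : path_cat p (path_cat (infcat x lam) q) 1 = pt by rewrite !path_catE1.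
by exists (LoopAt (ucont_path ltr01 uL) L0 L1).
Qed.

(** Up to the common beginning and end, the two loops have the chains of
    lam n and of the constant loop, which are thus e-homotopic. *)
Lemma infcat_separated lam lam' n e (L L' : loop_at pt) t :
  null_sequence x rad lam -> null_sequence x rad lam' ->
  (forall m, (m < n)%N -> lam m = lam' m) -> lam' n = cst x ->
  rad n.+1 <= e%:num / 2 ->
  L = path_cat p (path_cat (infcat x lam) q) :> (R -> X) ->
  L' = path_cat p (path_cat (infcat x lam') q) :> (R -> X) ->
  (forall s s', strong e L 0 1 s -> strong e L' 0 1 s' ->
    ehomotopic e pt (map L s) (map L' s')) ->
  strong e (lam n) 0 1 t ->
  ehomotopic e x (map (lam n) t) [::].
Proof.
move=> ns ns' ag lamx rn LE L'E LL' ht.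
have cn0 : 0 <= c n by rewrite -c0 c_mono.
have [s hs] := strong_exists e cn0 (infcat_ucont_head ns n).
have agn := infcat_agree ns ns' ag.
have hs' : strong e (infcat x lam') 0 (c n) s.
  apply: subdivision_impl hs => u v ? ? ? Q w ?.
  by rewrite -!agn; [exact: Q|lra|lra|lra].
have ht' : strong e (lam' n) 0 1 [:: 1].
  apply: subdivision_cons; [exact: ltr01| |exact: subdivision_nil].
  by move=> w _; rewrite lamx /cst mdistxx.
have [r hr er] := infcat_strong ns rn hs ht.
have [r' hr' er'] := infcat_strong ns' rn hs' ht'.
have [sp hp] := strong_exists e ler01 up.
have [sq hq] := strong_exists e ler01 uq.
have fq : infcat x lam 1 = q 0 by rewrite q0 infcat1.
have fq' : infcat x lam' 1 = q 0 by rewrite q0 infcat1.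
have pf : p 1 = path_cat (infcat x lam) q 0.
  by rewrite path_catE0 -c0 infcat_c.
have pf' : p 1 = path_cat (infcat x lam') q 0.
  by rewrite path_catE0 -c0 infcat_c.
have [s1 h1 e1] := path_cat_strong fq hr hq.
have [s2 h2 e2] := path_cat_strong pf hp h1.
have [s1' h1' e1'] := path_cat_strong fq' hr' hq.
have [s2' h2' e2'] := path_cat_strong pf' hp h1'.
have := LL' s2 s2'; rewrite LE L'E => /(_ h2 h2').
rewrite e2 e2' e1 e1' er er' lamx /=.
rewrite -(map_subdivision hs agn).
have [cp lp] := subdivision_chain hp; have [cq lq] := subdivision_chain hq.
have [cs ls] := subdivision_chain hs; have [ct lt] := subdivision_chain ht.
have fx0 : infcat x lam 0 = x by rewrite -c0 infcat_c.
rewrite p0 p1 q0 q1 fx0 infcat_c // (ns0 ns) (ns1 ns)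
  in cp lp cq lq cs ls ct lt.
have xx : mdist x x < e%:num by rewrite mdistxx.
have ctx : echain e x (map (lam n) t ++ [:: x]).
  by rewrite /echain cat_path -/(echain _ _ _) ct lt /= /eclose xx.
have cstx : echain e x (map (infcat x lam) s ++ map (lam n) t ++ [:: x]).
  by rewrite /echain cat_path -!/(echain _ _ _) cs ls.
have csxx : echain e x (map (infcat x lam) s ++ [:: x; x]).
  by rewrite /echain cat_path -!/(echain _ _ _) cs ls /echain /= /eclose xx.
have c3 : echain e x
    ((map (infcat x lam) s ++ map (lam n) t ++ [:: x]) ++ map q sq).
  by rewrite /echain cat_path -!/(echain _ _ _) cstx !last_cat.
move=> /ehomotopic_cancell; rewrite lp => /(_ cp c3).
move=> /ehomotopic_cancelr; rewrite !last_cat /= => /(_ erefl cstx csxx cq).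
move=> /ehomotopic_cancell; rewrite ls => /(_ cs ctx) H.
have {H} H : ehomotopic e x (map (lam n) t) [:: x].
  apply: (@ehomotopic_cancelr _ _ e x _ [:: x] [:: x]) H; rewrite ?lt //=;
  by rewrite /echain /= /eclose xx.
by apply: (ehomotopic_trans H); apply: (ehomotopic_dup (s := [::])).
Qed.

End InfiniteConcatenation.

(** * Countability *)

Lemma cantor_bool (g : (nat -> bool) -> nat) : ~ injective g.
Proof.
move=> gi; pose D n := ~~ `[< exists s, g s = n /\ s n >].
have : D (g D) = ~~ D (g D); last by case: (D _).
rewrite {1}/D; congr (~~ _); apply/asboolP/idP => [[s [/gi -> //]]|Dg].
by exists D.
Qed.

Theorem proposition4p3 (R : realType) (X : metricType R) (pt : X)
    (geoX : geodesic_space X) (ctbl : countable (pi1bar pt)) :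
  (forall x : X, exists2 r : R, 0 < r &
    forall (a b : R) (f : R -> X), path_loop a b f ->
      f @` `[a, b] `<=` ball x r ->
      forall e : {posnum R}, lifts_closed pt e a b f) /\
  semilocally_r_simply_connected pt.
Proof.
suff H : forall x : X, exists2 r : R, 0 < r &
    forall (a b : R) (f : R -> X), path_loop a b f ->
      f @` `[a, b] `<=` ball x r ->
      forall e : {posnum R}, lifts_closed pt e a b f.
  split=> // x; have [r r0 h] := H x; exists r => // a b f fl _; exact: h.
move=> x; apply: contrapT => nx.
have bad (r : {posnum R}) : exists le : (R -> X) * {posnum R},
    bad_loop x r%:num le.1 le.2.
  apply: contrapT => nb; apply: nx; exists r%:num => // a b f fl fr e.
  apply: contrapT => /(bad_loop_exists geoX fl fr)[l hl]; apply: nb.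
  by exists (l, e).
have [B HB] := choice bad.
(* The next radius is at most half the current scale, which makes all later
   loops invisible at that scale, and half the current radius, which makes the
   radii tend to 0. *)
have /choice[next hnext] : forall r : {posnum R}, exists r' : {posnum R},
    r'%:num <= r%:num / 2 /\ r'%:num <= (B r).2%:num / 2.
  move=> r; have d0 : 0 < Num.min (r%:num / 2) ((B r).2%:num / 2) by [].
  by exists (PosNum d0); rewrite /= !ge_min !lexx orbT.
pose rp n := iter n next (PosNum (@ltr01 R)).
pose rad n := (rp n)%:num.
pose l n := (B (rp n)).1.
have rad_gt0 n : 0 < rad n by rewrite /rad.
have radS n : rad n.+1 <= rad n / 2.
  by case: (hnext (rp n)).
have radSe n : rad n.+1 <= (B (rp n)).2%:num / 2.
  by case: (hnext (rp n)).
have rad_mono n m : (n <= m)%N -> rad m <= rad n.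
  elim: m => [|m IH]; first by rewrite leqn0 => /eqP ->.
  rewrite leq_eqVlt => /predU1P[-> //|/IH]; apply: le_trans.
  by have := radS m; have := rad_gt0 m; lra.
have radX n : rad n <= (1 / 2) ^+ n.
  elim: n => [|n IH]; first by rewrite expr0.
  by rewrite exprS; have := radS n; lra.
have rad_cvg (e : R) : 0 < e -> exists n, rad n < e.
  move=> e0; have h : `|1 / 2 : R| < 1 by rewrite ger0_norm; lra.
  have /cvgr0Pnorm_lt/(_ e e0)[N _ /(_ N (leqnn _)) /=] :=
      @cvg_geometric _ 1 _ h.
  rewrite /geometric /= !mul1r => hN; exists N; apply: le_lt_trans (radX N) _.
  by rewrite mul1r; exact: le_lt_trans (ler_norm _) hN.
pose lam (s : nat -> bool) n := if s n then l n else cst x.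
have ns s : null_sequence x rad (lam s).
  split=> n; rewrite /lam; case: (s n) => //; try by case: (HB (rp n)).
    by move=> e e0; exists 1 => // u v _ _ _; rewrite /cst mdistxx.
  by move=> t _; rewrite /cst mdistxx.
have [p [up p0 p1 _]] := geodesic_path geoX pt x.
have [q [uq q0 q1 _]] := geodesic_path geoX x pt.
have [L LE] := choice (fun s =>
    infcat_loop rad_mono rad_cvg rad_gt0 up uq p0 p1 q0 q1 (ns s)).
pose coset s : set (pi1 pt) :=
  [set (\pi_(pi1 pt)%qT (L s) * k)%g | k in pi_cl pt].
have /countable_injP[g gi] := ctbl.
apply: (@cantor_bool (g \o coset)) => s s' /= gss'.
have cE : coset s = coset s'.
  by apply: gi => //; rewrite inE; eexists.
apply: contrapT => ss'.
have [n nP nmin] : exists2 n, s n != s' n & forall m, (m < n)%N -> s m = s' m.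
  have ex : exists n, s n != s' n.
    apply: contrapT => nex; apply: ss'; apply/funext => n; apply/eqP.
    by apply: contrapT => /negP ?; apply: nex; exists n.
  case: (ex_minnP ex) => n hn hmin; exists n => // m mn; apply/eqP.
  by apply: contraTT mn => /hmin; rewrite -leqNgt.
have sep t t' : coset t = coset t' -> t n -> ~~ t' n ->
    (forall m, (m < n)%N -> t m = t' m) -> False.
  move=> ct tn tn' tt'.
  have [ul _ _ _ nb] := HB (rp n).
  have [w hw] := strong_exists (B (rp n)).2 ler01 ul.
  apply: (nb w hw).
  have := @infcat_separated _ _ x rad rad_mono rad_cvg rad_gt0 pt p q
    up uq p0 p1 q0 q1 (lam t) (lam t') n (B (rp n)).2 (L t) (L t') w
    (ns t) (ns t').
  have -> : lam t n = l n by rewrite /lam tn.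
  have -> : lam t' n = cst x by rewrite /lam (negbTE tn').
  apply => //.
    by move=> m mn; rewrite /lam tt'.
  exact: coset_homotopic ct _.
move: nP; case sn: (s n); case sn': (s' n) => // _.
  by apply: (sep s s') => //; rewrite sn'.
by apply: (sep s' s) => //; [rewrite sn|move=> m /nmin].
Qed.
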